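(* Let $\mathcal Y,\mathcal U,\mathcal V$ be separable Hilbert spaces, let $\nu\in\mathbb P(\mathcal Y\times\mathcal U)$ with $\mathcal Y$-marginal $\nu_{\mathcal Y}$, let $\eta_{\mathcal V}\in\mathbb P(\mathcal V)$, and set $\eta=\nu_{\mathcal Y}\otimes\eta_{\mathcal V}\in\mathbb P(\mathcal Y\times\mathcal V)$. Let $c:(\mathcal Y\times\mathcal V)\times(\mathcal Y\times\mathcal U)\to\mathbb R$ be lower semicontinuous and non-negative, and let $K(\pi)=\int_{\mathcal Y\times\mathcal V\times\mathcal Y\times\mathcal U} c(z,v;y,u)\,\mathrm d\pi(z,v;y,u)$. Then $$\begin{aligned}\inf_{\pi\in\Pi_{\mathcal Y}(\eta,\nu)}K(\pi)&=\sup_{\psi\in L^1(\eta)}\left(\int_{\mathcal Y\times\mathcal U}\psi^c_v(z,u)\,\mathrm d\nu(z,u)-\int_{\mathcal Y\times\mathcal V}\psi(z,v)\,\mathrm d\eta(z,v)\right)\\&=\sup_{\phi\in L^1(\nu)}\left(\int_{\mathcal Y\times\mathcal U}\phi(y,u)\,\mathrm d\nu(y,u)-\int_{\mathcal Y\times\mathcal V}\phi^c_u(y,v)\,\mathrm d\eta(y,v)\right),\end{aligned}$$ where $$\psi^c_v(z,u):=\inf_{v}\big(\psi(z,v)+c(z,v;z,u)\big),\qquad \phi^c_u(y,v):=\sup_{u}\big(\phi(y,u)-c(y,v;y,u)\big)$$ are the partial $c$-transforms of $\psi$ and $\phi$ respectively.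
   Context: $\mathbb P(\mathcal X)$ denotes the Borel probability measures on $\mathcal X$. $\Pi(\eta,\nu)$ is the set of couplings of $\eta$ and $\nu$, and $$\Pi_{\mathcal Y}(\eta,\nu)=\{\pi\in\Pi(\eta,\nu):\ (z,v;y,u)\sim\pi\text{ is such that } z=y\},$$ that is, the couplings concentrated on the set $\{z=y\}$, where $(z,v)\in\mathcal Y\times\mathcal V$ and $(y,u)\in\mathcal Y\times\mathcal U$. $L^1(\eta)$ and $L^1(\nu)$ denote the functions on $\mathcal Y\times\mathcal V$ and $\mathcal Y\times\mathcal U$ that are integrable with respect to $\eta$ and $\nu$, respectively. In the partial $c$-transforms the infimum is over $v\in\mathcal V$ and the supremum is over $u\in\mathcal U$. *)

(* Defs.v *)
From HB Require Import structures.
From mathcomp Require Import all_boot all_order all_algebra.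
From mathcomp Require Import sesquilinear.
From mathcomp Require Import all_classical all_reals all_analysis.

Set Implicit Arguments.
Unset Strict Implicit.
Unset Printing Implicit Defensive.

Import Order.TTheory GRing.Theory Num.Theory.
Import numFieldNormedType.Exports.

Local Open Scope classical_set_scope.
Local Open Scope ring_scope.
Local Open Scope ereal_scope.

(* Completeness is part of [completeNormedModType]; what is added is that the
   norm comes from an inner product. *)
Definition hilbert (R : realType) (H : completeNormedModType R) : Prop :=
  exists dot : {dot H for (@idfun R)}, forall x : H, (`|x| ^+ 2 = dot x x)%R.

Definition separable (T : topologicalType) : Prop :=
  exists2 D : set T, countable D & dense D.

(* [T] with its Borel sigma-algebra. On a product, [borel (X * Y)] is the
   sigma-algebra generated by the open sets of the product topology, as opposed
   to the product sigma-algebra carried by [borel X * borel Y]. *)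
Notation borel T := (g_sigma_algebraType (@open T)).

Section couplings.
Context {R : realType} {X1 X2 : normedModType R}.

Definition marginal1 (m : set (borel (X1 * X2)%type) -> \bar R) :
    set (borel X1) -> \bar R :=
  pushforward m (fst : borel (X1 * X2)%type -> borel X1).

Definition marginal2 (m : set (borel (X1 * X2)%type) -> \bar R) :
    set (borel X2) -> \bar R :=
  pushforward m (snd : borel (X1 * X2)%type -> borel X2).

(* The library's [m1 \x m2] lives on [borel X1 * borel X2]; both types have
   carrier [X1 * X2], so it can be evaluated on the Borel sets of [X1 * X2]. *)
Definition is_product (m : set (borel (X1 * X2)%type) -> \bar R)
    (m1 : set (borel X1) -> \bar R) (m2 : set (borel X2) -> \bar R) : Prop :=
  forall A : set (borel (X1 * X2)%type), measurable A -> m A = (m1 \x m2) A.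

Definition couplings (m1 : set (borel X1) -> \bar R)
    (m2 : set (borel X2) -> \bar R) :
    set (probability (borel (X1 * X2)%type) R) :=
  [set pi | (forall A : set (borel X1), measurable A -> marginal1 pi A = m1 A)
         /\ (forall B : set (borel X2), measurable B -> marginal2 pi B = m2 B)].

End couplings.

Section conditional_transport.
Context {R : realType} {Y U V : normedModType R}.
Implicit Types (c : (Y * V) * (Y * U) -> R).

Definition couplingsY (eta : set (borel (Y * V)%type) -> \bar R)
    (nu : set (borel (Y * U)%type) -> \bar R) :
    set (probability (borel ((Y * V) * (Y * U))%type) R) :=
  [set pi | couplings (X1 := (Y * V)%type) (X2 := (Y * U)%type) eta nu pi
         /\ pi [set x : (Y * V) * (Y * U) | x.1.1 = x.2.1] = 1].

Definition transport_cost c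
    (pi : set (borel ((Y * V) * (Y * U))%type) -> \bar R) : \bar R :=
  \int[pi]_x (c x)%:E.

Definition ctransform_v c (psi : Y * V -> R) (p : Y * U) : \bar R :=
  ereal_inf
    (range (fun v : V => (psi (p.1, v) + c ((p.1, v), (p.1, p.2)))%:E)).

Definition ctransform_u c (phi : Y * U -> R) (p : Y * V) : \bar R :=
  ereal_sup
    (range (fun u : U => (phi (p.1, u) - c ((p.1, p.2), (p.1, u)))%:E)).

(* The transforms of Borel functions are only universally measurable in
   general. [integral] is the difference of the lower integrals of the positive
   and negative parts, so on such functions it is the integral for the
   completed measure. *)
Definition dual_v c (eta : set (borel (Y * V)%type) -> \bar R)
    (nu : set (borel (Y * U)%type) -> \bar R) (psi : Y * V -> R) : \bar R :=
  \int[nu]_p ctransform_v c psi p - \int[eta]_q (psi q)%:E.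

Definition dual_u c (eta : set (borel (Y * V)%type) -> \bar R)
    (nu : set (borel (Y * U)%type) -> \bar R) (phi : Y * U -> R) : \bar R :=
  \int[nu]_p (phi p)%:E - \int[eta]_q ctransform_u c phi q.

End conditional_transport.

Definition L1 {R : realType} {X : normedModType R}
    (m : set (borel X) -> \bar R) : set (X -> R) :=
  [set f | m.-integrable [set: borel X] (EFin \o (f : borel X -> R))].

(* Main.v *)
Require Import Defs.
From HB Require Import structures.
From mathcomp Require Import all_boot all_order all_algebra.
From mathcomp Require Import all_classical all_reals all_analysis.
From mathcomp Require Import measurable_realfun ring lra.

(** Adding the constraint [z = y] to the problem gives a Kantorovich duality in
    which the inequality [phi(y,u) - psi(z,v) <= c] is required on the closed
    diagonal [{z = y}] only; for such a pair, [phi <= psi^c_v] and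
    [phi^c_u <= psi], so both dual values dominate [int phi - int psi].

    The optimal coupling comes from Hahn-Banach. If [D] bounds all the admissible
    [int phi - int psi], price a bounded function [h] by the infimum of
    [int phi - int psi + t D] over the [phi - psi + t c >= h] with [t >= 0].
    A linear functional below this sublinear one gives, on indicators, a finitely
    additive charge on all subsets, with marginals [eta] and [nu], null off the
    diagonal and of cost at most [D]. The marginals are tight (Ulam), so the
    charge is tight, hence countably additive on the algebra of the sets that it
    approximates by compact sets from inside and by open sets from outside; this
    algebra contains the measurable rectangles, and Caratheodory's extension is
    the coupling. Its cost is at most [D] because the superlevel sets of [c] are
    open, and the extension does not exceed the charge on open sets.

    For weak duality the transforms need not be Borel, but the compact sets used
    in the approximation of a coupling have compact projections, which bounds
    their lower integrals. *)

Set Implicit Arguments.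
Unset Strict Implicit.
Unset Printing Implicit Defensive.

Import Order.TTheory GRing.Theory Num.Theory.
Import numFieldNormedType.Exports.

Local Open Scope classical_set_scope.
Local Open Scope ring_scope.

(** * Hahn-Banach *)

Section hahn_banach.
Context {R : realType} {V : lmodType R}.
Implicit Types (p q : V -> R) (x y : V).

(** Only one inequality of positive homogeneity is asked for; applying it to [t^-1] gives the
    other. *)
Definition sublinear p :=
  (forall x y, p (x + y) <= p x + p y) /\
  (forall t x, 0 < t -> p (t *: x) <= t * p x).

Lemma sublinearZ p t x : sublinear p -> 0 < t -> p (t *: x) = t * p x.
Proof.
move=> [_ pZ] t0; apply/eqP; rewrite eq_le pZ//=.
have ti0 : 0 < t^-1 by rewrite invr_gt0.
have := pZ t^-1 (t *: x) ti0.
by rewrite scalerA mulVf ?gt_eqF// scale1r ler_pdivlMl.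
Qed.

Lemma sublinear0 p : sublinear p -> p 0 = 0.
Proof.
move=> sp; have := sublinearZ 0 sp (@ltr0Sn R 1); rewrite scaler0.
by move=> h; lra.
Qed.

Lemma sublinearN p x : sublinear p -> - p (- x) <= p x.
Proof.
move=> sp; have := sp.1 x (- x); rewrite subrr sublinear0//; lra.
Qed.

Definition sublinear_below p := {q | sublinear q /\ forall x, q x <= p x}.

(** The order is reversed, so that Zorn's lemma yields a minimal functional. *)
Definition sublinear_ge p (q q' : sublinear_below p) : bool :=
  `[< forall x, sval q' x <= sval q x >].

(** The bound is the pointwise infimum of the chain, finite because [q x >= - p (- x)] for each
    sublinear [q] below [p]. Subadditivity uses totality: of two members of the chain, the smaller
    one serves for both arguments. *)
Lemma sublinear_chain_lb p (A : set (sublinear_below p)) : sublinear p ->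
  total_on A (@sublinear_ge p) -> exists t, forall s, A s -> sublinear_ge s t.
Proof.
move=> sp totA; have [->|/set0P[s0 As0]] := eqVneq A set0.
  by exists (exist _ p (conj sp (fun=> lexx _))).
pose E x := [set sval s x | s in A].
have E0 x : E x !=set0 by exists (sval s0 x), s0.
have Elb x : has_lbound (E x).
  exists (- p (- x)) => _ [[q [sq qp]] _ <-] /=.
  by apply: le_trans (sublinearN x sq); rewrite lerN2.
have Ele s x : A s -> inf (E x) <= sval s x.
  by move=> As; apply: ge_inf => //; exists s.
have sinf : sublinear (fun x => inf (E x)).
  split => [x y|t x t0].
    rewrite -lerBlDr; apply: lb_le_inf => // _ [s As <-].
    rewrite lerBlDl -lerBlDr; apply: lb_le_inf => // _ [s' As' <-].
    rewrite lerBlDr; have [ss'|ss'] := totA _ _ As As'; move/asboolP : ss' => ss'.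
      rewrite (le_trans (Ele _ _ As'))// [leRHS]addrC.
      by rewrite (le_trans ((svalP s').1.1 _ _))// lerD2r.
    rewrite (le_trans (Ele _ _ As))// [leRHS]addrC.
    by rewrite (le_trans ((svalP s).1.1 _ _))// lerD2l.
  rewrite -ler_pdivrMl//; apply: lb_le_inf => // _ [s As <-].
  by rewrite ler_pdivrMl// -(sublinearZ _ (svalP s).1)//; exact: Ele.
have infp x : inf (E x) <= p x.
  by rewrite (le_trans (Ele _ _ As0))//; exact: (svalP s0).2.
pose t : sublinear_below p := exist _ (fun x => inf (E x)) (conj sinf infp).
exists t => s As; apply/asboolP => x /=.
exact: Ele.
Qed.

(** The classical lowering of [p] in the direction [y]: [t = 0] shows that it is at most [p x], and
    [t = 1] that it is at most [p (x + y) - p y], which is superadditivity once [p] cannot be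
    lowered. *)
Definition sublinear_shift p y x :=
  inf [set p (x + t *: y) - t * p y | t in [set t | 0 <= t]].

Lemma sublinear_shift_le p y x t : sublinear p -> 0 <= t ->
  sublinear_shift p y x <= p (x + t *: y) - t * p y.
Proof.
move=> sp t0; apply: ge_inf; last by exists t.
(* Lower bound: [u * p y = p (u *: y) <= p (x + u *: y) + p (- x)]. *)
exists (- p (- x)) => _ [u /= u0 <-]; rewrite -lerBlDr opprK addrC lerBlDr.
have [->|un0] := eqVneq u 0.
  by rewrite mul0r scale0r addr0; have := sublinearN x sp; lra.
rewrite -(sublinearZ _ sp) ?lt_def ?un0//.
by rewrite (le_trans _ (sp.1 _ _))// addrAC subrr add0r.
Qed.

Lemma sublinear_shift_sublinear p y : sublinear p ->
  sublinear (sublinear_shift p y).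
Proof.
move=> sp; split => [x x'|a x a0].
  rewrite -lerBlDr; apply: lb_le_inf.
    by exists (p (x + 0 *: y) - 0 * p y), 0 => /=.
  move=> _ [t /= t0 <-]; rewrite lerBlDl -lerBlDr; apply: lb_le_inf.
    by exists (p (x' + 0 *: y) - 0 * p y), 0 => /=.
  move=> _ [t' /= t'0 <-]; rewrite lerBlDr.
  rewrite (le_trans (sublinear_shift_le _ _ sp (addr_ge0 t0 t'0)))//.
  have := sp.1 (x + t *: y) (x' + t' *: y).
  rewrite addrACA -scalerDl; lra.
rewrite -ler_pdivrMl//; apply: lb_le_inf.
  by exists (p (x + 0 *: y) - 0 * p y), 0 => /=.
move=> _ [t /= t0 <-]; rewrite ler_pdivrMl//.
rewrite (le_trans (sublinear_shift_le _ _ sp (mulr_ge0 (ltW a0) t0)))//.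
by rewrite mulrBr -(sublinearZ (x + t *: y) sp a0) scalerDr scalerA mulrA.
Qed.

(* A minimal sublinear functional is linear: it cannot be lowered by
   [sublinear_shift]. *)
Lemma hahn_banach p : sublinear p -> exists f : V -> R,
  [/\ forall x y, f (x + y) = f x + f y,
      forall a x, f (a *: x) = a * f x & forall x, f x <= p x].
Proof.
move=> sp; have [||||[q [sq qp]] qmin] := @Zorn _ (@sublinear_ge p).
- by move=> s; exact/asboolP.
- move=> r s t /asboolP rs /asboolP st; apply/asboolP => x.
  exact: le_trans (st x) (rs x).
- move=> [s Ps] [t Pt] /asboolP/= st /asboolP/= ts; apply: eq_exist.
  by apply/funext => x; apply/eqP; rewrite eq_le st ts.
- by move=> A; exact: sublinear_chain_lb.
have shiftE y x : sublinear_shift q y x = q x.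
  have sqp z : sublinear_shift q y z <= q z.
    have := sublinear_shift_le y z sq (lexx 0).
    by rewrite scale0r mul0r addr0 subr0.
  pose s : sublinear_below p := exist _ (sublinear_shift q y)
    (conj (sublinear_shift_sublinear y sq) (fun z => le_trans (sqp z) (qp z))).
  have /(congr1 sval)/= : s = exist _ q (conj sq qp).
    by apply: qmin; apply/asboolP => z; exact: sqp.
  by move=> ->.
have qD x y : q (x + y) = q x + q y.
  apply/eqP; rewrite eq_le sq.1/= -lerBrDr -[leLHS](shiftE y x).
  by have := sublinear_shift_le y x sq ler01; rewrite scale1r mul1r.
have qN x : q (- x) = - q x.
  by apply/eqP; rewrite -addr_eq0 -qD addNr (sublinear0 sq) eqxx.
exists q; split => // a x; case: (ltgtP a 0) => [a0|a0|->].
- by rewrite -[a]opprK scaleNr qN (sublinearZ _ sq) ?oppr_gt0// !mulNr.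
- exact: sublinearZ.
- by rewrite scale0r mul0r sublinear0.
Qed.

End hahn_banach.

(** * Compact-open regularity *)

Section regular_sets.
Context {R : realType} {X : normedModType R}.
Implicit Types (m : set X -> \bar R) (A K G : set X).

(** [m] is a bare set function, so that the same notions serve measures, outer measures and finitely
    additive charges. *)
Definition tight m :=
  forall e : R, 0 < e -> exists2 K, compact K & (m (~` K) <= e%:E)%E.

Definition regular_set m A := forall e : R, 0 < e ->
  exists K G, [/\ compact K, open G, K `<=` A, A `<=` G
    & (m (G `\` K) <= e%:E)%E].

Lemma compact_closed_normed K : compact K -> closed K.
Proof. by apply: compact_closed; exact: norm_hausdorff. Qed.

Context (m : set X -> \bar R).
Hypotheses (m0 : m set0 = 0%E) (m_mono : {homo m : A B / A `<=` B >-> (A <= B)%E})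
  (m_subU : forall A B, (m (A `|` B) <= m A + m B)%E).

Let m_le2 A B C (e : R) : A `<=` B `|` C ->
  (m B <= (e / 2)%:E)%E -> (m C <= (e / 2)%:E)%E -> (m A <= e%:E)%E.
Proof.
move=> ABC mB mC; apply: (le_trans (m_mono ABC)); apply: (le_trans (m_subU _ _)).
by rewrite [e in leRHS]splitr EFinD leeD.
Qed.

Lemma regular_set0 : regular_set m set0.
Proof.
move=> e e0; exists set0, set0; split => //; [exact: compact0|exact: open0|].
by rewrite setD0 m0 lee_fin ltW.
Qed.

Lemma regular_setU A B :
  regular_set m A -> regular_set m B -> regular_set m (A `|` B).
Proof.
move=> rA rB e e0; have e20 : 0 < e / 2 by rewrite divr_gt0.
have [K [G [cK oG KA AG mGK]]] := rA _ e20.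
have [K' [G' [cK' oG' KB BG mGK']]] := rB _ e20.
exists (K `|` K'), (G `|` G'); split.
- exact: compactU.
- exact: openU.
- exact: setUSS.
- exact: setUSS.
- apply: m_le2 mGK mGK' => x [[Gx|Gx] /not_orP[nK nK']]; [left|right]; by split.
Qed.

(** The complement of the outer open set is closed but need not be compact; it is cut by a compact
    set of nearly full mass. *)
Lemma regular_setC A : tight m -> regular_set m A -> regular_set m (~` A).
Proof.
move=> tm rA e e0; have e20 : 0 < e / 2 by rewrite divr_gt0.
have [K [G [cK oG KA AG mGK]]] := rA _ e20; have [C cC mC] := tm _ e20.
exists (C `&` ~` G), (~` K); split.
- by apply: compact_closedI => //; exact: open_closedC.
- by apply: closed_openC; exact: compact_closed_normed.
- by move=> x [_ nGx] Ax; apply: nGx; exact: AG.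
- exact: subsetC.
- apply: m_le2 mGK mC => x [nKx /not_andP[Cx|/contrapT Gx]]; [by right|by left].
Qed.

End regular_sets.

(** * Exhaustion of open sets by closed sets *)

Section open_exhaustion.
Context {R : realType} {X : normedModType R}.
Implicit Types (A K G : set X).

(** The points at distance at least [1/(n+1)] from the complement of [G], in a form that involves no
    infimum over a possibly empty complement. *)
Definition inner_closed G n : set X :=
  [set x | forall y, `|x - y| < n.+1%:R^-1 -> G y].

Lemma inner_closed_closed G n : closed (inner_closed G n).
Proof.
move=> x clx y xy; pose d : R := n.+1%:R^-1 - `|x - y|.
have d0 : 0 < d by rewrite subr_gt0.
have [z [Gz xz]] := clx _ (nbhsx_ballx x d d0).
apply: Gz; move: xz; rewrite -ball_normE /ball_/= distrC => xz.
rewrite (le_lt_trans (ler_distD x _ _))// -ltrBrDr//.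
Qed.

Lemma inner_closed_sub G n : inner_closed G n `<=` G.
Proof. by move=> x; apply; rewrite subrr normr0 invr_gt0. Qed.

Lemma inner_closed_bigcup G : open G -> \bigcup_n inner_closed G n = G.
Proof.
move=> oG; apply/seteqP; split=> [x [n _ /inner_closed_sub]//|x Gx].
have /nbhs_ballP[e /= e0 xeG] := open_nbhs_nbhs (conj oG Gx).
have [n ne] : exists n, n.+1%:R^-1 <= e.
  exists (Num.truncn e^-1); rewrite -[leRHS]invrK lef_pV2 ?posrE ?invr_gt0//.
  by rewrite ltW// truncnS_gt.
exists n => // y xy; apply: xeG; rewrite -ball_normE /ball_/=.
exact: lt_le_trans ne.
Qed.

Lemma inner_closed_mono G : {homo inner_closed G : n k / (n <= k)%N >-> n `<=` k}.
Proof.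
move=> n k nk x Gx y xy; apply: Gx; apply: (lt_le_trans xy).
by rewrite lef_pV2 ?posrE// ler_nat ltnS.
Qed.

End open_exhaustion.

Section borel_sets.
Context {R : realType} {X : normedModType R}.
Implicit Types A K : set X.

Lemma open_borel A : open A -> measurable (A : set (borel X)).
Proof. exact: sub_sigma_algebra. Qed.

Lemma closed_borel A : closed A -> measurable (A : set (borel X)).
Proof.
move=> cA; rewrite -[A]setCK; apply: measurableC.
by apply: open_borel; exact: closed_openC.
Qed.

Lemma borel_measurable_fun d (T : measurableType d) (f : T -> X) :
  (forall G, open G -> measurable (f @^-1` G)) ->
  measurable_fun [set: T] (f : T -> borel X).
Proof.
move=> fG; apply: (@measurability _ _ T (borel X) setT f (@open X)) => //.
by move=> _ [G oG <-]; rewrite setTI; exact: fG.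
Qed.

End borel_sets.

Lemma compact_borel {R : realType} {X : normedModType R} (K : set X) :
  compact K -> measurable (K : set (borel X)).
Proof. by move=> cK; apply: closed_borel; exact: compact_closed_normed. Qed.

Lemma continuous_borel_measurable {R : realType} {X W : normedModType R}
    (p : X -> W) : continuous p ->
  measurable_fun [set: borel X] (p : borel X -> borel W).
Proof.
move=> cp; apply: borel_measurable_fun => G oG; apply: open_borel.
by apply: open_comp => // x _; exact: cp.
Qed.

Section decreasing_small.
Local Open Scope ereal_scope.

Lemma decreasing_measure_lt d (T : measurableType d) (R : realType)
    (mu : probability T R) (F : (set T)^nat) (e : \bar R) :
  (forall n, measurable (F n)) ->
  {homo F : n m / (n <= m)%N >-> m `<=` n} ->
  mu (\bigcap_n F n) < e -> exists n, mu (F n) < e.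
Proof.
move=> mF ndF muFe.
have F0 : mu (F 0%N) < +oo by rewrite (le_lt_trans (probability_le1 mu (mF _)))// ltry.
have cmu : mu \o F @ \oo --> mu (\bigcap_n F n).
  apply: nonincreasing_cvg_mu => //; first exact: bigcapT_measurable.
  by move=> n m nm; apply/subsetPset; exact: ndF.
have /cmu : nbhs (mu (\bigcap_n F n)) [set y | y < e].
  by apply: open_nbhs_nbhs; split => //; exact: open_ereal_lt_ereal.
by case=> n _ /(_ n (leqnn n)) muFn; exists n.
Qed.

End decreasing_small.

(** * Regularity of tight Borel probability measures *)

Section borel_regularity.
Context {R : realType} {X : normedModType R}.
Variable mu : probability (borel X) R.
Hypothesis tmu : tight mu.
Implicit Types (A K G : set X).
Local Open Scope ereal_scope.

(** The outer measure agrees with [mu] on Borel sets and is monotone and subadditive on all sets, so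
    regular sets can be handled before they are known to be Borel. *)
Let m : set X -> \bar R := mu_ext mu.

Let mE A : measurable (A : set (borel X)) -> m A = mu A.
Proof. exact: measurable_mu_extE. Qed.

Let m_sub A B : A `<=` B -> m A <= m B.
Proof. exact: (@le_mu_ext _ (borel X) R mu A B). Qed.

Let m_bigcup (F : (set X)^nat) : m (\bigcup_n F n) <= \sum_(n <oo) m (F n).
Proof. exact: (outer_measure_sigma_subadditive (mu_ext mu) F). Qed.

Let m_setU A B : m (A `|` B) <= m A + m B.
Proof. exact: (outer_measureU2 (mu_ext mu) A B). Qed.

Let tight_m : tight m.
Proof.
move=> e e0; have [K cK muK] := tmu e0; exists K => //.
by rewrite mE//; apply: measurableC; exact: compact_borel.
Qed.

(** The compact core is an inner closed set carrying almost all of [A], cut by a compact set from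
    tightness; the outer open set is [A] itself. *)
Let regular_open A : open A -> regular_set m A.
Proof.
move=> oA e e0; have e20 : (0 < e / 2)%R by rewrite divr_gt0.
have [C cC mC] := tight_m e20.
have [n mun] : exists n, mu (A `\` inner_closed A n : set (borel X)) < (e / 2)%:E.
  apply: decreasing_measure_lt.
  - move=> n; apply: measurableD; first exact: open_borel.
    by apply: closed_borel; exact: inner_closed_closed.
  - by move=> n k nk; apply: setDS; exact: inner_closed_mono.
  - rewrite [X in mu X](_ : _ = set0) ?measure0 ?lte_fin// -subset0.
    move=> x Ax; have : A x by have [] := Ax 0%N Logic.I.
    by rewrite -{1}(inner_closed_bigcup oA) => -[k _]; have [] := Ax k Logic.I.
exists (C `&` inner_closed A n), A; split => //.
- by apply: compact_closedI => //; exact: inner_closed_closed.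
- by move=> x [_ /inner_closed_sub].
- rewrite [e in leRHS]splitr EFinD.
  apply: (@le_trans _ _ (m (~` C `|` A `\` inner_closed A n))).
    by apply: m_sub => x [Ax /not_andP[nC|nA]]; [left|right].
  rewrite (le_trans (m_setU _ _))// leeD// mE ?ltW//.
  apply: measurableD; first exact: open_borel.
  by apply: closed_borel; exact: inner_closed_closed.
Qed.

(** The union of all the cores need not be compact, so finitely many are kept: the sets [D n]
    decrease to a set covered by the gaps between [G k] and [K k], of total mass at most [e / 2],
    and continuity from above gives an [n] with mass below [e]. *)
Let regular_bigcup (A : (set X)^nat) :
  (forall n, regular_set m (A n)) -> regular_set m (\bigcup_n A n).
Proof.
move=> rA e e0; have e20 : (0 < e / 2)%R by rewrite divr_gt0.
pose d n : R := (e / 2 / (2 ^ n.+1)%:R)%R.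
have d0 n : (0 < d n)%R by rewrite divr_gt0// ltr0n expn_gt0.
have /choice[K /choice[G KG]] n : exists K G, [/\ compact K, open G, K `<=` A n,
    A n `<=` G & m (G `\` K) <= (d n)%:E].
  exact: rA.
have oG : open (\bigcup_n G n) by apply: bigcup_open => n _; case: (KG n).
pose D n : set X := (\bigcup_k G k) `\` \big[setU/set0]_(i < n) K i.
have mK n : compact (\big[setU/set0]_(i < n) K i).
  by apply: bigsetU_compact => i _; case: (KG i).
have mD n : measurable (D n : set (borel X)).
  by apply: measurableD; [exact: open_borel|exact: compact_borel].
have [n mun] : exists n, mu (D n : set (borel X)) < e%:E.
  apply: decreasing_measure_lt => //.
    by move=> n k nk; apply: setDS; exact: subset_bigsetU.
  rewrite -mE; last exact: bigcapT_measurable.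
  apply: (@le_lt_trans _ _ (e / 2)%:E); last by rewrite lte_fin gtr_pMr// invf_lt1// ltr1n.
  apply: (@le_trans _ _ (m (\bigcup_n (G n `\` K n)))).
    apply: m_sub => x Dx; have [[k _ Gx] _] := Dx 0%N Logic.I; exists k => //.
    split=> // Kx; have [_] := Dx k.+1 Logic.I; apply.
    by rewrite big_ord_recr/=; right.
  apply: (le_trans (m_bigcup _)).
  apply: (le_trans _ (epsilon_trick0 xpredT (ltW e20))).
  apply: lee_nneseries => k _; first by move=> _; exact: (outer_measure_ge0 (mu_ext mu)).
  by case: (KG k).
exists (\big[setU/set0]_(i < n) K i), (\bigcup_n G n); split => //.
- rewrite -bigcup_mkord => x [k _ Kx]; exists k => //.
  by case: (KG k) => _ _ /(_ _ Kx).
- by apply: subset_bigcup => k _; case: (KG k).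
- by rewrite mE ?ltW//; exact: mD.
Qed.

(** The regular sets form a sigma-algebra that contains the open sets. *)
Lemma borel_regular A : measurable (A : set (borel X)) -> regular_set mu A.
Proof.
move=> mA; suff : regular_set m A.
  move=> rA e e0; have [K [G [cK oG KA AG mGK]]] := rA e e0.
  exists K, G; split => //; rewrite -mE//.
  by apply: measurableD; [exact: open_borel|exact: compact_borel].
move: A mA; apply: smallest_sub; last exact: regular_open.
split.
- by apply: regular_set0; exact: (outer_measure0 (mu_ext mu)).
- by move=> A rA; rewrite setTD; apply: regular_setC.
- exact: regular_bigcup.
Qed.

End borel_regularity.

(** * Tightness *)

Lemma separable_seq {R : realType} (X : normedModType R) : separable X ->
  exists f : nat -> X, forall x (e : R), 0 < e -> exists n, `|f n - x| < e.
Proof.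
move=> [D /countable_injP[g ginj] dD].
(* Inverts the injection [g]; an index outside its image yields the default point, which is harmless
   for density. *)
exists (fun n => get [set x | D x /\ g x = n]) => x e e0.
have [|y [xy Dy]] := dD (ball x e) _ (ball_open x e).
  by exists x; exact: ballxx.
exists (g y); case: xgetP => [z _ [Dz gz]|/(_ y)]; last by case.
have -> : z = y by apply: ginj => //; exact: mem_set.
by move: xy; rewrite -ball_normE /ball_/= distrC.
Qed.

Lemma ultra_bigsetU {T : Type} (F : set_system T) (A : nat -> set T) n :
  UltraFilter F -> F (\big[setU/set0]_(i < n) A i) -> exists i, F (A i).
Proof.
move=> UF; elim: n => [|n ih]; first by rewrite big_ord0 => /filter_ex[].
rewrite big_ord_recr/= => FU.
have [FA|FnA] := in_ultra_setVsetC (A n) UF; first by exists n.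
apply: ih; apply: filterS (filterI FU FnA).
by move=> x [[//|]].
Qed.

(* Totally bounded and closed sets are compact in a complete space. *)
Lemma compact_closed_balls {R : realType} (X : completeNormedModType R)
    (f : nat -> X) (N : nat -> nat) :
  compact (\bigcap_n \big[setU/set0]_(i < N n) closed_ball (f i) n.+1%:R^-1).
Proof.
set K := \bigcap_n _.
have cK : closed K.
  by apply: closed_bigI => n _; apply: closed_bigsetU => i _; exact: closed_ball_closed.
rewrite compact_ultra => F UF FK.
have /cvg_ex[x Fx] : cvg F.
  apply: cauchy_cvg; apply: cauchy_exP => e e0.
  have [n ne] : exists n, n.+1%:R^-1 < e.
    exists (Num.truncn e^-1); rewrite -[ltRHS]invrK ltf_pV2 ?posrE ?invr_gt0//.
    exact: truncnS_gt.
  have [|i Fi] := @ultra_bigsetU _ F (fun i => closed_ball (f i) n.+1%:R^-1) (N n) UF.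
    by apply: filterS FK => y /(_ n Logic.I).
  exists (f i); apply: filterS Fi => y; rewrite closed_ballE// /closed_ball_/=.
  by rewrite -ball_normE /ball_/= => /le_lt_trans; apply.
exists x; split => //=.
by apply: (closed_cvg _ cK _ _ Fx).
Qed.

(** At each scale [1/(n+1)], finitely many closed balls around the dense sequence carry all but
    [d n] of the mass; their intersection over the scales is compact, and the losses sum to at most
    [e]. *)
Lemma ulam {R : realType} (X : completeNormedModType R)
  (mu : probability (borel X) R) : separable X -> tight mu.
Proof.
move=> /separable_seq[f df] e e0.
pose d n : R := e / (2 ^ n.+1)%:R.
have d0 n : 0 < d n by rewrite divr_gt0// ltr0n expn_gt0.
pose U n N : set X := ~` \big[setU/set0]_(i < N) closed_ball (f i) n.+1%:R^-1.
have mU n N : measurable (U n N : set (borel X)).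
  apply: measurableC; apply: closed_borel; apply: closed_bigsetU => i _.
  exact: closed_ball_closed.
have /choice[N muN] n : exists N, (mu (U n N : set (borel X)) < (d n)%:E)%E.
  apply: decreasing_measure_lt => //.
    move=> N M NM x UM UN; apply: UM.
    exact: (@subset_bigsetU _ (fun i => closed_ball (f i) n.+1%:R^-1) _ _ NM).
  rewrite (_ : \bigcap_N _ = set0) ?measure0 ?lte_fin// -subset0 => x Ux.
  have n0 : 0 < n.+1%:R^-1 :> R by rewrite invr_gt0.
  have [k fk] := df x _ n0; have := Ux k.+1 Logic.I; apply.
  rewrite big_ord_recr/=; right; rewrite closed_ballE//.
  exact: ltW.
exists (\bigcap_n ~` U n (N n)).
  under eq_bigcapr do rewrite setCK.
  exact: compact_closed_balls.
rewrite setC_bigcap; under eq_bigcupr do rewrite setCK.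
apply: (@le_trans _ _ (\sum_(n <oo) mu (U n (N n) : set (borel X)))%E).
  by apply: measure_sigma_subadditive => //; exact: bigcupT_measurable.
apply: (le_trans _ (epsilon_trick0 xpredT (ltW e0))).
apply: lee_nneseries => n _; first by move=> _; exact: measure_ge0.
exact: ltW.
Qed.

(** What lies outside the product of [K1] and [K2] lies over the complement of one of them. Upper
    bounds on the marginals suffice, so the lemma applies to the charge before its marginals are
    identified. *)
Lemma tight_prod {R : realType} {X1 X2 : normedModType R} (m : set (X1 * X2) -> \bar R)
    (m1 : set X1 -> \bar R) (m2 : set X2 -> \bar R) :
  {homo m : A B / A `<=` B >-> (A <= B)%E} ->
  (forall A B, (m (A `|` B) <= m A + m B)%E) ->
  (forall K, compact K -> (m (fst @^-1` ~` K) <= m1 (~` K))%E) ->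
  (forall K, compact K -> (m (snd @^-1` ~` K) <= m2 (~` K))%E) ->
  tight m1 -> tight m2 -> tight m.
Proof.
move=> m_mono m_subU le_m1 le_m2 t1 t2 e e0.
have e20 : 0 < e / 2 by rewrite divr_gt0.
have [K1 cK1 mK1] := t1 _ e20; have [K2 cK2 mK2] := t2 _ e20.
exists (K1 `*` K2); first exact: compact_setX.
apply: (@le_trans _ _ (m ((fst @^-1` (~` K1)) `|` (snd @^-1` (~` K2))))).
  by apply: m_mono => x /not_andP[nx|nx]; [left|right].
apply: (le_trans (m_subU _ _)); rewrite [e in leRHS]splitr EFinD leeD//.
  exact: le_trans (le_m1 _ cK1) mK1.
exact: le_trans (le_m2 _ cK2) mK2.
Qed.

(** * From tight finitely additive charges to measures *)

Record tight_charge (R : realType) (X : normedModType R) := TightCharge {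
  charge :> set X -> R ;
  charge_ge0 : forall A, 0 <= charge A ;
  chargeU : forall A B, A `&` B = set0 -> charge (A `|` B) = charge A + charge B ;
  charge_tight : tight (EFin \o charge) }.

Section tight_charge_theory.
Context {R : realType} {X : normedModType R} (m : tight_charge X).
Implicit Types A B : set X.

Lemma charge0 : m set0 = 0.
Proof. by have := chargeU m (setI0 set0); rewrite setU0 => h; lra. Qed.

Lemma le_charge : {homo m : A B / A `<=` B >-> A <= B}.
Proof.
move=> A B AB; rewrite -(setDUK AB) chargeU ?setDIK//.
by rewrite lerDl charge_ge0.
Qed.

Lemma charge_subU A B : m (A `|` B) <= m A + m B.
Proof.
rewrite -(setDUK (@subsetUl _ A B)).
rewrite chargeU ?setDIK// lerD2l; apply: le_charge.
by move=> x [[]].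
Qed.

Lemma charge_bigsetU (F : nat -> set X) n :
  m (\big[setU/set0]_(i < n) F i) <= \sum_(i < n) m (F i).
Proof.
elim: n => [|n ih]; first by rewrite !big_ord0 charge0.
by rewrite !big_ord_recr/= (le_trans (charge_subU _ _))// lerD2r.
Qed.

Let m0 : (EFin \o m) set0 = 0%E. Proof. by rewrite /= charge0. Qed.

Let m_sub : {homo EFin \o m : A B / A `<=` B >-> (A <= B)%E}.
Proof. by move=> A B AB; rewrite lee_fin le_charge. Qed.

Let m_subU A B : ((EFin \o m) (A `|` B) <= (EFin \o m) A + (EFin \o m) B)%E.
Proof. by rewrite /= -EFinD lee_fin charge_subU. Qed.

Lemma charge_regular0 : regular_set (EFin \o m) set0.
Proof. exact: regular_set0. Qed.

Lemma charge_regularU : setU_closed (regular_set (EFin \o m)).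
Proof. by move=> A B; exact: regular_setU. Qed.

Lemma charge_regularC : setC_closed (regular_set (EFin \o m)).
Proof. by move=> A; apply: regular_setC => //; exact: charge_tight. Qed.

End tight_charge_theory.

(** An alias of [X] that remembers [m], so that the algebra of its regular sets can be attached as a
    structure. *)
Definition charge_algebra (R : realType) (X : normedModType R)
  (m : tight_charge X) : Type := X.

Section charge_algebra.
Context {R : realType} {X : normedModType R} (m : tight_charge X).
Local Notation T := (charge_algebra m).

HB.instance Definition _ := Pointed.on T.
HB.instance Definition _ := @isAlgebraOfSets.Build default_measure_display T
  (regular_set (EFin \o m)) (charge_regular0 m) (@charge_regularU _ _ m)
  (@charge_regularC _ _ m).

Definition charge_content (A : set T) : \bar R := (m A)%:E.
Local Open Scope ereal_scope.

Let charge_content_ge0 A : 0 <= charge_content A.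
Proof. by rewrite lee_fin charge_ge0. Qed.

Let charge_content_additive : measure_function.semi_additive charge_content.
Proof.
apply/additive2P; first by rewrite /charge_content charge0.
by move=> A B _ _ AB; rewrite /charge_content chargeU.
Qed.

HB.instance Definition _ := isContent.Build _ T R charge_content
  charge_content_ge0 charge_content_additive.

(* Compactness reduces a countable cover to a finite one. *)
Let charge_content_sigma_subadditive :
  measurable_subset_sigma_subadditive charge_content.
Proof.
move=> A F rF rA AF.
apply/lee_addgt0Pr => e e0; have e20 : (0 < e / 2)%R by rewrite divr_gt0.
pose d n : R := (e / 2 / (2 ^ n.+1)%:R)%R.
have d0 n : (0 < d n)%R by rewrite divr_gt0// ltr0n expn_gt0.
have [K [G [cK oG KA AG mGK]]] := rA _ e20.
have /choice[L /choice[H LH]] n : exists L H, [/\ compact L, open H, L `<=` F n,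
    F n `<=` H & (EFin \o m) (H `\` L) <= (d n)%:E].
  exact: rF.
have mH n : (m (H n) <= m (F n) + d n)%R.
  have [_ _ LF FH mHL] := LH n.
  rewrite (le_trans _ (lerD (lexx _) mHL))// -[H n in leLHS](setDUK (subset_trans LF FH)).
  by rewrite (le_trans (charge_subU _ _ _))// lerD2r le_charge.
have [N KN] : exists N, K `<=` \big[setU/set0]_(i < N) H i.
  have KH : K `<=` cover setT H.
    move=> x /KA /AF [n _ Fx]; exists n => //.
    by have [_ _ _ /(_ _ Fx)] := LH n.
  have := cK; rewrite compact_cover => /(_ _ setT H).
  move=> /(_ (fun n _ => let: And5 _ oH _ _ _ := LH n in oH) KH)[D _ KD].
  (* The finite subcover is enlarged to an initial segment; the successor makes room for the largest
     index. *)
  exists (\max_(i <- finmap.enum_fset D) i).+1 => x /KD[i /= iD Hx].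
  rewrite -bigcup_mkord; exists i => //=.
  by rewrite ltnS; apply: leq_bigmax_seq.
have mA : (m A <= m K + e / 2)%R.
  rewrite (le_trans _ (lerD (lexx _) mGK))// -[A in leLHS](setDUK KA).
  rewrite (le_trans (charge_subU _ _ _))// lerD2l le_charge//.
  exact: setSD.
apply: (@le_trans _ _ (m K + e / 2)%:E) => //.
rewrite [e in leRHS]splitr 2!EFinD addeA leeD//.
apply: (le_trans _ (epsilon_trick xpredT _ (ltW e20))); last first.
  by move=> n; exact: charge_content_ge0.
apply: (@le_trans _ _ (\sum_(0 <= i < N) (charge_content (F i) + (d i)%:E))); last first.
  apply: nneseries_lim_ge => i _.
  by rewrite adde_ge0// lee_fin ltW.
rewrite big_mkord; under eq_bigr do rewrite /charge_content -EFinD.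
rewrite sumEFin lee_fin (le_trans (le_charge m KN))//.
rewrite (le_trans (charge_bigsetU _ _ _))//.
by apply: ler_sum => i _.
Qed.

HB.instance Definition _ := Content_SigmaSubAdditive_isMeasure.Build _ R T
  charge_content charge_content_sigma_subadditive.

End charge_algebra.

(** The extension lives on the sigma-algebra generated by the regular sets, and the hypothesis on
    open sets puts the Borel sets into it. On an open set only an inequality is claimed: the
    extension is the limit along finite unions of regular pieces, while the charge may be larger on
    the whole union. *)
Lemma charge_measure {R : realType} {X : normedModType R} (m : tight_charge X) :
  m setT = 1 ->
  (forall G, open G -> exists2 B : nat -> set X,
    forall n, open (B n) /\ regular_set (EFin \o m) (B n) & G = \bigcup_n B n) ->
  exists2 pi : probability (borel X) R,
    forall A : set X, regular_set (EFin \o m) A -> pi A = (m A)%:E &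
    forall G : set X, open G -> (pi G <= (m G)%:E)%E.
Proof.
move=> mT basis.
pose mu : {measure set (charge_algebra m) -> \bar R} := @charge_content R X m.
(* Pushing forward along the identity restricts the extension to the Borel sets. *)
have mid : measurable_fun [set: g_sigma_algebraType (@measurable _ (charge_algebra m))]
    (id : g_sigma_algebraType (@measurable _ (charge_algebra m)) -> borel X).
  apply: borel_measurable_fun => G oG; rewrite preimage_id.
  have [B oB ->] := basis _ oG; apply: bigcupT_measurable => n.
  by apply: sub_sigma_algebra; have [] := oB n.
pose pi_of : {measure set (borel X) -> \bar R} :=
  pushforward (measure_extension mu)
    (id : g_sigma_algebraType (@measurable _ (charge_algebra m)) -> borel X).
pose pi0 := pi_of mid.
have piE A : regular_set (EFin \o m) A -> pi0 A = (m A)%:E.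
  by move=> rA; rewrite /pi0/= /pushforward preimage_id /measure_extension measurable_mu_extE.
have piT : pi0 setT = 1%E.
  by rewrite piE ?mT// -setC0; apply: charge_regularC; exact: charge_regular0.
pose pi : probability (borel X) R := HB.pack (pi0 : set _ -> \bar R)
  (Measure.class pi0) (Measure_isProbability.Build _ _ _ pi0 piT).
exists pi => [A /piE//|G oG].
have [B oB GE] := basis _ oG.
pose C n := \big[setU/set0]_(i < n) B i.
have rC n : regular_set (EFin \o m) (C n).
  apply: big_ind => [||i _]; [exact: charge_regular0|exact: charge_regularU|].
  by have [] := oB i.
have GC : \bigcup_n C n = G.
  rewrite GE; apply/seteqP; split=> x [n _].
    by rewrite /C -bigcup_mkord => -[k _ Bx]; exists k.
  by move=> Bx; exists n.+1 => //; rewrite /C big_ord_recr/=; right.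
have mC n : measurable (C n : set (borel X)).
  apply: open_borel; rewrite /C -bigcup_mkord.
  by apply: bigcup_open => i _; have [] := oB i.
have cvgC : (pi \o C @ \oo --> pi (\bigcup_n C n))%classic.
  apply: nondecreasing_cvg_mu => //; first exact: bigcupT_measurable.
  by move=> n k nk; apply/subsetPset; exact: subset_bigsetU.
rewrite -{1}GC -(cvg_lim _ cvgC)//; apply: lime_le; first by apply/cvg_ex; eexists; exact: cvgC.
apply: nearW => n /=; rewrite piE// lee_fin; apply: le_charge.
by rewrite -GC; exact: bigcup_sup.
Qed.

(** * Dominated linear functionals *)

Section bounded_functions.
Context (R : realType) (Z : Type).

(** Bounded functions are packed as a submodule, to which [hahn_banach] applies. *)
Definition bounded_fun_pred : {pred Z -> R^o} :=
  mem [set f : Z -> R^o | exists M : R, forall z, `|f z| <= M].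

Record bounded_function := BoundedFunction {
  bounded_fun_val :> Z -> R^o ; _ : bounded_fun_val \in bounded_fun_pred }.

HB.instance Definition _ := [isSub for bounded_fun_val].
HB.instance Definition _ := [Choice of bounded_function by <:].

Lemma bounded_fun_submod_closed : submod_closed bounded_fun_pred.
Proof.
split; first by rewrite inE; exists 0 => z; rewrite normr0.
move=> a f g; rewrite !inE => -[M fM] [N gN]; exists (`|a| * M + N) => z.
rewrite (le_trans (ler_normD _ _))// lerD//.
by rewrite [X in `|X|](_ : _ = a * f z)// normrM ler_wpM2l.
Qed.

HB.instance Definition _ := GRing.isSubmodClosed.Build _ _ bounded_fun_pred
  bounded_fun_submod_closed.
HB.instance Definition _ := [SubChoice_isSubLmodule of bounded_function by <:].

Definition bounded_on (f : Z -> R) := exists M : R, forall z, `|f z| <= M.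

(* The functional [S h] below is the cheapest price [v] of a payoff [g]
   dominating [h]; any linear functional below it prices bounded payoffs. *)
Lemma cone_functional (P : (Z -> R) -> R -> Prop) :
  (forall g g' v v', P g v -> P g' v' -> P (g \+ g') (v + v')) ->
  (forall t g v, 0 < t -> P g v -> P (fun z => t * g z) (t * v)) ->
  (forall a, P (cst a) a) ->
  (forall g v, P g v -> (forall z, 0 <= g z) -> 0 <= v) ->
  exists L : (Z -> R) -> R,
  [/\ forall f g, bounded_on f -> bounded_on g -> L (f \+ g) = L f + L g,
      forall a f, bounded_on f -> L (fun z => a * f z) = a * L f &
      forall h g v, bounded_on h -> P g v -> (forall z, h z <= g z) -> L h <= v].
Proof.
move=> PD PZ Pcst Pge0.
pose E (h : bounded_function) := [set v | exists2 g, P g v & forall z, h z <= g z].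
pose S h := inf (E h).
have E0 h : E h !=set0.
  have /set_mem[M hM] := valP h; exists M, (cst M) => // z.
  by rewrite (le_trans (ler_norm _))//; exact: hM.
have Elb h : has_lbound (E h).
  have /set_mem[M hM] := valP h; exists (- M) => v [g Pg hg].
  (* [g + M >= h + M >= 0], so its price [v + M] is non-negative. *)
  rewrite -subr_ge0 opprK; apply: (Pge0 (g \+ cst M)); first exact: PD.
  move=> z /=; rewrite -lerBlDr sub0r (le_trans _ (hg z))// lerNl.
  by rewrite (le_trans _ (hM z))// -normrN ler_norm.
have SE h v : E h v -> S h <= v by move=> Ev; exact: ge_inf.
have S_sub : sublinear S.
  split=> [h h'|t h t0].
    rewrite -lerBlDr; apply: lb_le_inf => // v [g Pg hg].
    rewrite lerBlDl -lerBlDr; apply: lb_le_inf => // v' [g' Pg' hg'].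
    rewrite lerBlDr [leRHS]addrC; apply: SE; exists (g \+ g'); first exact: PD.
    by move=> z; rewrite lerD.
  rewrite -ler_pdivrMl//; apply: lb_le_inf => // v [g Pg hg].
  rewrite ler_pdivrMl//; apply: SE; exists (fun z => t * g z); first exact: PZ.
  by move=> z; rewrite ler_pM2l.
have [F [FD FZ FS]] := hahn_banach S_sub.
pose B f (bf : bounded_on f) := @BoundedFunction f (mem_set bf).
have insubdE f (bf : bounded_on f) : insubd (0 : bounded_function) f = B f bf.
  by apply: val_inj; rewrite /= insubdK//; exact: mem_set.
(* Unbounded functions are sent to the default [0]; the three laws evaluate the functional at
   bounded functions only. *)
exists (fun f => F (insubd 0 f)); split => [f g bf bg|a f bf|h g v bh Pg hg].
- rewrite (insubdE _ bf) (insubdE _ bg) -FD; congr F.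
  by apply: val_inj; rewrite insubdK//; exact: (valP (B f bf + B g bg)).
- rewrite (insubdE _ bf) -FZ; congr F.
  by apply: val_inj; rewrite insubdK//; exact: (valP (a *: B f bf)).
- by rewrite (insubdE _ bh) (le_trans (FS _))//; apply: SE; exists g.
Qed.

End bounded_functions.

(** * The dual cone *)

Lemma separable_prod {R : realType} (X1 X2 : normedModType R) :
  separable X1 -> separable X2 -> separable (X1 * X2)%type.
Proof.
move=> [D1 cD1 dD1] [D2 cD2 dD2]; exists (D1 `*` D2); first exact: countableX.
move=> O [x Ox] oO.
have /nbhs_ballP[e /= e0 xeO] := open_nbhs_nbhs (conj oO Ox).
have [|y1 [xy1 Dy1]] := dD1 (ball x.1 e) _ (ball_open _ _).
  by exists x.1; exact: ballxx.
have [|y2 [xy2 Dy2]] := dD2 (ball x.2 e) _ (ball_open _ _).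
  by exists x.2; exact: ballxx.
by exists (y1, y2); split => //; apply: xeO.
Qed.

Lemma ball_half {R : realType} (X : normedModType R) (a x y : X) (r e : R) :
  r < e / 2 -> `|a - x| < r -> ball a r y -> ball x e y.
Proof.
rewrite distrC -!ball_normE /ball_/= => re xa ay.
rewrite (le_lt_trans (ler_distD a _ _))// [ltRHS]splitr ltrD//.
  exact: lt_trans re.
exact: lt_trans re.
Qed.

(** The rectangles are products of balls of equal radius [1/(k+1)] around two dense sequences, coded
    by triples; those not inside [G] are made empty, which leaves a single sequence. *)
Lemma open_rectangles {R : realType} (X1 X2 : normedModType R) (G : set (X1 * X2)) :
  separable X1 -> separable X2 -> open G ->
  exists A B, [/\ forall n : nat, open (A n : set X1),
    forall n, open (B n : set X2) & G = \bigcup_n (A n `*` B n)].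
Proof.
move=> /separable_seq[f1 df1] /separable_seq[f2 df2] oG.
pose r (t : nat * nat * nat) :=
  ball (f1 t.1.1) t.2.+1%:R^-1 `*` ball (f2 t.1.2) t.2.+1%:R^-1.
pose A n : set X1 := if @unpickle (nat * nat * nat)%type n is Some t then
  if `[< r t `<=` G >] then ball (f1 t.1.1) t.2.+1%:R^-1 else set0 else set0.
pose B n : set X2 := if @unpickle (nat * nat * nat)%type n is Some t then
  ball (f2 t.1.2) t.2.+1%:R^-1 else set0.
exists A, B; split.
- rewrite /A => n; case: unpickle => [t|]; last exact: open0.
  by case: ifPn => _; [exact: ball_open|exact: open0].
- by rewrite /B => n; case: unpickle => [t|]; [exact: ball_open|exact: open0].
apply/seteqP; split=> [x Gx|x [n _]]; last first.
  rewrite /A /B; case: unpickle => [t|]; last by case.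
  by case: ifPn => [/asboolP rG|_]; [exact: rG|case].
have /nbhs_ballP[e /= e0 xeG] := open_nbhs_nbhs (conj oG Gx).
have [k ke] : exists k, k.+1%:R^-1 < e / 2.
  exists (Num.truncn (e / 2)^-1); rewrite -[ltRHS]invrK ltf_pV2 ?posrE ?invr_gt0 ?divr_gt0//.
  exact: truncnS_gt.
have k0 : 0 < k.+1%:R^-1 :> R by rewrite invr_gt0.
have [i fi] := df1 x.1 _ k0; have [j fj] := df2 x.2 _ k0.
have rG : r (i, j, k) `<=` G.
  move=> y [y1 y2]; apply: xeG; split.
  - exact: ball_half ke fi y1.
  - exact: ball_half ke fj y2.
exists (pickle (i, j, k)) => //; rewrite /A /B pickleK.
rewrite ifT; last exact/asboolP.
by split; rewrite -ball_normE.
Qed.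

Section integral_probability.
Context d (T : measurableType d) (R : realType) (mu : probability T R).

Lemma Rintegral_probability_cst (a : R) : \int[mu]_(_ in setT) a = a.
Proof.
rewrite Rintegral_cst// -[RHS]mulr1; congr (_ * _).
by have /(congr1 fine) := probability_setT mu.
Qed.

Lemma Rintegral_indic (A : set T) : measurable A ->
  (\int[mu]_x (\1_A : T -> R) x)%:E = mu A.
Proof.
move=> mA; rewrite /Rintegral fineK; last first.
  by apply: integrable_fin_num => //; exact: integrable_indic.
by rewrite integral_indic// setIT.
Qed.

End integral_probability.

Section dual_cone.
Context {R : realType} {X1 X2 : normedModType R}.
Variables (mu1 : probability (borel X1) R) (mu2 : probability (borel X2) R).
Variables (Delta : set (X1 * X2)) (c : X1 * X2 -> R) (D : R).
Hypothesis c_ge0 : forall x, 0 <= c x.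

Definition dual_bound := forall (psi : X1 -> R) (phi : X2 -> R),
  L1 mu1 psi -> L1 mu2 phi ->
  (forall x, Delta x -> phi x.2 - psi x.1 <= c x) ->
  \int[mu2]_y phi y - \int[mu1]_x psi x <= D.

(* [v] is the price of a portfolio of [phi], [- psi] and [t] units of the cost,
   each worth [D], that dominates [g] on [Delta]. *)
Definition dual_cone (g : X1 * X2 -> R) (v : R) := exists psi phi t,
  [/\ L1 mu1 psi, L1 mu2 phi, 0 <= t,
    forall x, Delta x -> g x <= phi x.2 - psi x.1 + t * c x &
    v = \int[mu2]_y phi y - \int[mu1]_x psi x + t * D].

Lemma L1D (X : normedModType R) (mu : probability (borel X) R) (f g : X -> R) :
  L1 mu f -> L1 mu g -> L1 mu (f \+ g) /\
  \int[mu]_x (f \+ g) x = \int[mu]_x f x + \int[mu]_x g x.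
Proof.
move=> mf mg; split; last exact: RintegralD.
exact: (integrableD measurableT mf mg).
Qed.

Lemma L1Z (X : normedModType R) (mu : probability (borel X) R) (f : X -> R) t :
  L1 mu f -> L1 mu (fun x => t * f x) /\
  \int[mu]_x (t * f x) = t * \int[mu]_x f x.
Proof.
move=> mf; split; last exact: RintegralZl.
exact: (integrableZl measurableT _ mf).
Qed.

Lemma L1cst (X : normedModType R) (mu : probability (borel X) R) (a : R) :
  L1 mu (cst a : X -> R) /\ \int[mu]_x (cst a) x = a.
Proof.
split; last exact: Rintegral_probability_cst.
by apply: (@finite_measure_integrable_cst _ _ _ mu).
Qed.

Lemma L1indic (X : normedModType R) (mu : probability (borel X) R) (A : set X) :
  measurable (A : set (borel X)) ->
  L1 mu (\1_A : X -> R) /\ (\int[mu]_x (\1_A : X -> R) x)%:E = mu A.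
Proof.
move=> mA; split; last exact: Rintegral_indic.
exact: (@integrable_indic _ _ _ mu).
Qed.

Lemma dual_coneD g g' v v' : dual_cone g v -> dual_cone g' v' ->
  dual_cone (g \+ g') (v + v').
Proof.
move=> [psi [phi [t [Lpsi Lphi t0 gle ->]]]] [psi' [phi' [t' [Lpsi' Lphi' t'0 gle' ->]]]].
have [Lpsi2 E1] := L1D Lpsi Lpsi'; have [Lphi2 E2] := L1D Lphi Lphi'.
exists (psi \+ psi'), (phi \+ phi'), (t + t'); split => //.
- exact: addr_ge0.
- by move=> x Dx /=; have := gle x Dx; have := gle' x Dx; lra.
- by rewrite E1 E2; ring.
Qed.

Lemma dual_coneZ s g v : 0 < s -> dual_cone g v ->
  dual_cone (fun z => s * g z) (s * v).
Proof.
move=> s0 [psi [phi [t [Lpsi Lphi t0 gle ->]]]].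
have [Lpsi2 E1] := L1Z s Lpsi; have [Lphi2 E2] := L1Z s Lphi.
exists (fun x => s * psi x), (fun x => s * phi x), (s * t); split => //.
- by rewrite mulr_ge0// ltW.
- move=> x Dx /=; have := gle x Dx; rewrite -(ler_pM2l s0).
  by move=> /le_trans; apply; rewrite le_eqVlt; apply/orP; left; apply/eqP; ring.
- by rewrite E1 E2; ring.
Qed.

Lemma dual_cone_cst a : dual_cone (cst a) a.
Proof.
have [L0 E0] := L1cst mu1 0; have [La Ea] := L1cst mu2 a.
exists (cst 0), (cst a), 0; split => //.
- by move=> x _ /=; rewrite subr0 mul0r addr0.
- by rewrite E0 Ea; ring.
Qed.

Hypothesis dualD : dual_bound.

Lemma dual_bound_ge0 : 0 <= D.
Proof.
have [L01 E01] := L1cst mu1 0; have [L02 E02] := L1cst mu2 0.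
have := dualD L01 L02; rewrite E01 E02 subr0; apply => x _.
exact: c_ge0.
Qed.

(** If [0 <= phi - psi + t c] on [Delta], then for every positive [s >= t] the pair [- psi / s],
    [- phi / s] is admissible because [c >= 0], and [dual_bound] gives [0 <= i + s D]. For [t > 0]
    take [s = t]; for [t = 0] let [s] be small. *)
Lemma dual_cone_ge0 g v : dual_cone g v -> (forall z, 0 <= g z) -> 0 <= v.
Proof.
move=> [psi [phi [t [Lpsi Lphi t0 gle ->]]]] g0.
set i := _ - _.
have key s : 0 < s -> t <= s -> 0 <= i + s * D.
  move=> s0 ts.
  have [Lpsi2 E1] := L1Z (- s^-1) Lpsi; have [Lphi2 E2] := L1Z (- s^-1) Lphi.
  have feas x : Delta x -> - s^-1 * phi x.2 - - s^-1 * psi x.1 <= c x.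
    move=> Dx; rewrite -(ler_pM2l s0).
    rewrite [leLHS](_ : _ = psi x.1 - phi x.2); last by field; rewrite gt_eqF.
    have := gle x Dx; have := g0 x; have := ler_wpM2r (c_ge0 x) ts; lra.
  have := dualD Lpsi2 Lphi2 feas; rewrite E1 E2 -(ler_pM2l s0).
  rewrite [leLHS](_ : _ = - i); last by rewrite /i; field; rewrite gt_eqF.
  by rewrite -subr_ge0 opprK addrC.
have := t0; rewrite le_eqVlt => /predU1P[t00|t_gt0]; last exact: key.
rewrite -t00 mul0r addr0; apply/ler_addgt0Pr => e e0.
have D1 : 0 < D + 1 by rewrite ltr_wpDl// dual_bound_ge0.
(* This [s] makes [s * D] at most [e]; [D + 1] is positive even when [D = 0]. *)
have s0 : 0 < e / (D + 1) by rewrite divr_gt0.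
have := key _ s0; rewrite -t00 => /(_ (ltW s0))/le_trans; apply.
rewrite lerD2l mulrAC ler_pdivrMr// ler_pM2l// lerDl//.
Qed.

End dual_cone.

(** * Layer-cake bounds *)

Section layer_cake.
Context {R : realType}.

(** Approximation of [a] from below by steps of size [s]. The strict inequality makes the layers of
    a lower semicontinuous function open sets. *)
Definition layer_sum (s a : R) (N : nat) : R :=
  \sum_(k < N) s * (k.+1%:R * s < a)%R%:R.

Lemma layer_sumS s a N :
  layer_sum s a N.+1 = layer_sum s a N + s * (N.+1%:R * s < a)%R%:R.
Proof. by rewrite /layer_sum big_ord_recr. Qed.

Lemma layer_sum_le s a N : 0 < s -> 0 <= a -> layer_sum s a N <= a.
Proof.
(* The second bound closes the induction: when layer [N + 1] counts, the new sum is at most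
   [(N + 1) * s < a]. *)
move=> s0 a0; suff : layer_sum s a N <= a /\ layer_sum s a N <= N%:R * s by case.
elim: N => [|N [ih1 ih2]]; first by rewrite /layer_sum big_ord0 mul0r.
rewrite layer_sumS; case: ltP => [Na|_].
  by rewrite mulr1 -natr1 mulrDl mul1r in Na *; split; lra.
by rewrite mulr0 addr0 -natr1 mulrDl mul1r; split; lra.
Qed.

Lemma layer_sum_ge s a N : 0 < s -> a <= N%:R * s -> a <= s + layer_sum s a N.
Proof.
(* Either the sum is already within [s] of [a], or all [N] layers have counted. *)
move=> s0 aN; have : a <= s + layer_sum s a N \/ N%:R * s <= layer_sum s a N.
  elim: N {aN} => [|N [ih|ih]]; first by right; rewrite /layer_sum big_ord0 mul0r.
    left; rewrite layer_sumS (le_trans ih)// lerD2l lerDl.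
    by rewrite mulr_ge0 ?ler0n// ltW.
  rewrite layer_sumS; case: ltP => [_|aN].
    by right; rewrite mulr1 -natr1 mulrDl mul1r lerD2r.
  left; rewrite mulr0 addr0 (le_trans aN)// -natr1 mulrDl mul1r; lra.
by case=> //; lra.
Qed.

Local Open Scope ereal_scope.

(** [f] exceeds the sum of its layers of thickness [s] by at most [s], and [P] has mass one; the
    layers are integrated term by term, and [s] is arbitrary. *)
Lemma layer_cake_integral_le d (T : measurableType d) (P : probability T R)
    (f : T -> R) (D : R) :
  measurable_fun setT f -> (forall x, 0 <= f x)%R ->
  (forall (s : R) N, (0 < s)%R ->
    \sum_(k < N) s%:E * P [set x | (k.+1%:R * s < f x)%R] <= D%:E) ->
  \int[P]_x (f x)%:E <= D%:E.
Proof.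
move=> mf f0 layer; apply/lee_addgt0Pr => s s0.
pose U k := [set x | (k.+1%:R * s < f x)%R].
have mU k : measurable (U k).
  rewrite (_ : U k = f @^-1` `](k.+1%:R * s)%R, +oo[%classic).
    by rewrite -[X in measurable X]setTI; exact: mf.
  by apply/seteqP; split=> x /=; rewrite in_itv/= andbT.
pose g k x : \bar R := s%:E * (\1_(U k) x)%:E.
have g0 k x : 0 <= g k x by rewrite mule_ge0// lee_fin ?ltW.
have mg k : measurable_fun setT (g k).
  by apply: measurable_funeM; apply/measurable_EFinP.
have sumg N x : \sum_(0 <= k < N) g k x = (layer_sum s (f x) N)%:E.
  rewrite big_mkord /layer_sum -sumEFin; apply: eq_bigr => k _.
  by rewrite /g -EFinM indicE mem_setE.
have -> : D%:E + s%:E = s%:E + D%:E by rewrite addeC.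
apply: (@le_trans _ _ (\int[P]_x (s%:E + \sum_(k <oo) g k x))).
  apply: ge0_le_integral => //.
  - by move=> x _; rewrite lee_fin.
  - exact/measurable_EFinP.
  - apply: emeasurable_funD => //; exact: ge0_emeasurable_sum.
  - move=> x _; pose N := (Num.truncn (f x / s)).+1.
    apply: (@le_trans _ _ (s%:E + \sum_(0 <= k < N) g k x)); last first.
      by rewrite leeD2l// nneseries_lim_ge.
    rewrite sumg -EFinD lee_fin; apply: layer_sum_ge => //.
    by rewrite -ler_pdivrMr// ltW// truncnS_gt.
rewrite ge0_integralD//; last 3 first.
- by move=> x _; rewrite lee_fin ltW.
- by move=> x _; rewrite nneseries_ge0.
- exact: ge0_emeasurable_sum.
rewrite integral_cst// [X in _ * X]probability_setT mule1 leeD2l//.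
rewrite integral_nneseries//; apply: lime_le.
  by apply: is_cvg_nneseries => k _ _; exact: integral_ge0.
apply: nearW => N; apply: le_trans (layer s N s0).
rewrite big_mkord; apply: lee_sum => k _.
rewrite /g ge0_integralZl//= ?integral_indic ?setIT// ?lee_fin ?ltW//.
exact/measurable_EFinP.
Qed.

End layer_cake.

Lemma lsc_borel_measurable {R : realType} (X : normedModType R) (f : X -> R) :
  (forall r, open [set x | r < f x]) ->
  measurable_fun [set: borel X] (f : borel X -> R).
Proof.
move=> of_; apply: (measurability _ (RGenOInfty.measurableE R)).
move=> /= _ [_ [a ->]] <-; rewrite setTI; apply: open_borel.
rewrite (_ : _ @^-1` _ = [set x | a < f x])//.
by apply/seteqP; split=> x /=; rewrite in_itv/= andbT.
Qed.

(** * Existence of a coupling *)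

Lemma open_setX {T1 T2 : topologicalType} (A : set T1) (B : set T2) :
  open A -> open B -> open (A `*` B).
Proof.
move=> oA oB; rewrite openE => -[x y] [/= Ax By]; exists (A, B) => //=.
by split; apply: open_nbhs_nbhs.
Qed.

Lemma preimage_borel {R : realType} {X W : normedModType R} (p : X -> W)
    (A : set W) : continuous p -> measurable (A : set (borel W)) ->
  measurable (p @^-1` A : set (borel X)).
Proof.
move=> cp mA; rewrite -[X in measurable X]setTI.
exact: continuous_borel_measurable.
Qed.

Section kantorovich.
Context {R : realType} {X1 X2 : normedModType R}.
Variables (mu1 : probability (borel X1) R) (mu2 : probability (borel X2) R).
Variables (Delta : set (X1 * X2)) (c : X1 * X2 -> R) (D : R).
Hypotheses (sep1 : separable X1) (sep2 : separable X2).
Hypotheses (tight1 : tight mu1) (tight2 : tight mu2).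
Hypothesis closedDelta : closed Delta.
Hypothesis c_lsc : forall r, open [set x | r < c x].
Hypothesis c_ge0 : forall x, 0 <= c x.
Hypothesis dualD : dual_bound mu1 mu2 Delta c D.

Let cone := dual_cone mu1 mu2 Delta c D.

Let bounded_indic (A : set (X1 * X2)) : bounded_on (\1_A : X1 * X2 -> R).
Proof. by exists 1 => z; rewrite indicE; case: (_ \in _); rewrite ?normr1 ?normr0. Qed.

Let bounded_scale a (f : X1 * X2 -> R) : bounded_on f -> bounded_on (fun z => a * f z).
Proof.
by move=> [M fM]; exists (`|a| * M) => z; rewrite normrM ler_wpM2l.
Qed.

Section charge_of_functional.
Variable L : (X1 * X2 -> R) -> R.
Hypothesis LD : forall f g, bounded_on f -> bounded_on g -> L (f \+ g) = L f + L g.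
Hypothesis LZ : forall a f, bounded_on f -> L (fun z => a * f z) = a * L f.
Hypothesis Lcone : forall h g v, bounded_on h -> cone g v ->
  (forall z, h z <= g z) -> L h <= v.

Let m (A : set (X1 * X2)) : R := L (\1_A : X1 * X2 -> R).

Let m_ge0 A : 0 <= m A.
Proof.
have b1 := bounded_indic A.
rewrite -oppr_le0 -[- m A]mulN1r -LZ//; apply: Lcone (dual_cone_cst _ _ _ _ _ 0) _.
  exact: bounded_scale.
by move=> z /=; rewrite mulN1r oppr_le0.
Qed.

Let mU A B : A `&` B = set0 -> m (A `|` B) = m A + m B.
Proof.
move=> AB; rewrite /m -LD//; congr L; apply/funext => z /=.
rewrite !indicE in_setU; have : ~ (A z /\ B z).
  by move=> ABz; rewrite -[False]/(set0 z) -AB.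
by case: (boolP (z \in A)) => zA; case: (boolP (z \in B)) => zB;
  rewrite ?addr0 ?add0r//; rewrite !inE in zA zB => -[].
Qed.

Let mT : m setT = 1.
Proof.
have b1 := bounded_indic setT.
apply/eqP; rewrite eq_le; apply/andP; split.
  apply: Lcone (dual_cone_cst _ _ _ _ _ 1) _ => // z.
  by rewrite indicE in_setT.
rewrite -lerN2 -[- m setT]mulN1r -LZ//.
apply: Lcone (dual_cone_cst _ _ _ _ _ (- 1)) _; first exact: bounded_scale.
by move=> z; rewrite indicE in_setT mulr1.
Qed.

(** The portfolio [psi = - \1_A], [phi = 0] costs [mu1 A] and dominates the indicator of the
    preimage. *)
Let m1_le (A : set X1) : measurable (A : set (borel X1)) ->
  ((m (fst @^-1` A))%:E <= mu1 A)%E.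
Proof.
move=> mA; have [iA <-] := L1indic mu1 mA; rewrite lee_fin.
have [iNA NE] := L1Z (-1) iA; have [i0 E0] := L1cst mu2 0.
apply: (Lcone (g := fun z => \1_A z.1)) => //.
exists (fun x => -1 * \1_A x), (cst 0), 0; split => //.
- by move=> x _ /=; rewrite mulN1r opprK mul0r add0r addr0.
- by rewrite NE E0; ring.
Qed.

Let m2_le (A : set X2) : measurable (A : set (borel X2)) ->
  ((m (snd @^-1` A))%:E <= mu2 A)%E.
Proof.
move=> mA; have [iA <-] := L1indic mu2 mA; rewrite lee_fin.
have [i0 E0] := L1cst mu1 0.
apply: (Lcone (g := fun z => \1_A z.2)) => //.
exists (cst 0), (\1_A), 0; split => //.
- by move=> x _ /=; rewrite mul0r subr0 addr0.
- by rewrite E0; ring.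
Qed.

Let m_sub : {homo (fun A => (m A)%:E) : A B / A `<=` B >-> (A <= B)%E}.
Proof.
move=> A B AB; rewrite lee_fin -(setDUK AB) mU ?setDIK//.
by rewrite lerDl.
Qed.

Let m_subU A B : ((m (A `|` B))%:E <= (m A)%:E + (m B)%:E)%E.
Proof.
rewrite -(setDUK (@subsetUl _ A B)) mU ?setDIK// -EFinD lee_fin lerD2l.
by rewrite -lee_fin; apply: m_sub => x [[]].
Qed.

Let m_tight : tight (EFin \o m).
Proof.
apply: (tight_prod m_sub m_subU _ _ tight1 tight2) => K cK.
- by apply: m1_le; apply: measurableC; exact: compact_borel.
- by apply: m2_le; apply: measurableC; exact: compact_borel.
Qed.

Let charge := TightCharge m_ge0 mU m_tight.

(** What the product approximation misses lies over the gap of one of the sides, where the charge is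
    bounded by the marginals. *)
Let regular_rectangle (A : set X1) (B : set X2) :
  measurable (A : set (borel X1)) -> measurable (B : set (borel X2)) ->
  regular_set (EFin \o charge) (A `*` B).
Proof.
move=> mA mB e e0; have e20 : 0 < e / 2 by rewrite divr_gt0.
have [K1 [G1 [cK1 oG1 KA AG mGK1]]] := borel_regular tight1 mA e20.
have [K2 [G2 [cK2 oG2 KB BG mGK2]]] := borel_regular tight2 mB e20.
have mD1 : measurable (G1 `\` K1 : set (borel X1)).
  by apply: measurableD; [exact: open_borel|exact: compact_borel].
have mD2 : measurable (G2 `\` K2 : set (borel X2)).
  by apply: measurableD; [exact: open_borel|exact: compact_borel].
exists (K1 `*` K2), (G1 `*` G2); split.
- exact: compact_setX.
- exact: open_setX.
- by move=> x [x1 x2]; split; [exact: KA|exact: KB].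
- by move=> x [x1 x2]; split; [exact: AG|exact: BG].
- apply: (@le_trans _ _ ((m ((fst @^-1` (G1 `\` K1)) `|` (snd @^-1` (G2 `\` K2))))%:E)).
    by apply: m_sub => x [[G1x G2x] /not_andP[nK|nK]]; [left|right].
  apply: (le_trans (m_subU _ _)); rewrite [e in leRHS]splitr EFinD leeD//.
    exact: le_trans (m1_le mD1) mGK1.
  exact: le_trans (m2_le mD2) mGK2.
Qed.

(** The null portfolio suffices, since domination is required on [Delta] only, where this indicator
    vanishes. *)
Let m_Delta : m (~` Delta) <= 0.
Proof.
have [i1 E1] := L1cst mu1 0; have [i2 E2] := L1cst mu2 0.
apply: (Lcone (g := \1_(~` Delta))) => //.
exists (cst 0), (cst 0), 0; split => //.
- move=> x Dx /=; rewrite indicE memNset; last by move=> /(_ Dx).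
  by rewrite mul0r subr0 addr0.
- by rewrite E1 E2; ring.
Qed.

Let bounded_sum N (f : nat -> X1 * X2 -> R) : (forall k, bounded_on (f k)) ->
  bounded_on (fun z => \sum_(k < N) f k z) /\
  L (fun z => \sum_(k < N) f k z) = \sum_(k < N) L (f k).
Proof.
move=> bf; elim: N => [|N [ihb ihL]].
  under eq_fun do rewrite big_ord0.
  have b0 : bounded_on (fun=> 0 : R) by exists 0 => z; rewrite normr0.
  split; first exact: (b0 (X1 * X2)%type).
  rewrite big_ord0.
  rewrite -[RHS](mul0r (L \1_setT)) -LZ//; congr L; apply/funext => z.
  by rewrite mul0r.
under eq_fun do rewrite big_ord_recr/=.
split; last by rewrite big_ord_recr/= -ihL -LD.
have [M hM] := ihb; have [M' hM'] := bf N; exists (M + M') => z.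
by rewrite (le_trans (ler_normD _ _))// lerD.
Qed.

(** One unit of the cost, of price [D], dominates the sum of its layers. *)
Let m_layers s N : 0 < s ->
  \sum_(k < N) s * m [set x | k.+1%:R * s < c x] <= D.
Proof.
move=> s0; pose f k z : R := s * (\1_[set x | k.+1%:R * s < c x] : X1 * X2 -> R) z.
have bf k : bounded_on (f k) by apply: bounded_scale.
have [bS LS] := bounded_sum N bf.
under eq_bigr do rewrite -LZ//.
rewrite -LS; apply: (Lcone (g := fun z => \sum_(k < N) f k z)) => //.
have [i1 E1] := L1cst mu1 0; have [i2 E2] := L1cst mu2 0.
exists (cst 0), (cst 0), 1; split => //; last by rewrite E1 E2; ring.
move=> x _ /=; rewrite subr0 add0r mul1r.
apply: le_trans (layer_sum_le N s0 (c_ge0 x)).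
by rewrite le_eqVlt; apply/orP; left; apply/eqP/eq_bigr => k _; rewrite /f indicE mem_setE.
Qed.

(** Upper bounds on [A] and on its complement force equality, as both total masses are one. *)
Let m_marginal d (T : measurableType d) (mu : probability T R)
    (p : X1 * X2 -> T) (A : set T) : measurable A ->
  (forall B, measurable B -> ((m (p @^-1` B))%:E <= mu B)%E) ->
  (m (p @^-1` A))%:E = mu A.
Proof.
move=> mA mle; have mNA := mle _ (measurableC mA).
have muA : mu A \is a fin_num by exact: fin_num_measure.
have mE : m (p @^-1` A) + m (p @^-1` (~` A)) = 1.
  by rewrite -mU -?preimage_setU -?preimage_setI ?setUv ?setICr
    ?preimage_set0 ?preimage_setT.
have {mle} mA1 := mle _ mA.
rewrite probability_setC// in mNA.
move: mNA mA1; rewrite -(fineK muA) -EFinB !lee_fin => h1 h2.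
by congr EFin; lra.
Qed.

Lemma charge_coupling : exists pi : probability (borel (X1 * X2)%type) R,
  [/\ couplings mu1 mu2 pi, pi Delta = 1%E & (\int[pi]_x (c x)%:E <= D%:E)%E].
Proof.
have [//|G oG|pi piE piG] := @charge_measure R _ charge.
  have [A [B [oA oB ->]]] := open_rectangles sep1 sep2 oG.
  exists (fun n => A n `*` B n) => // n; split; first exact: open_setX.
  by apply: regular_rectangle; exact: open_borel.
exists pi; split.
- split => A mA; rewrite /marginal1 /marginal2 /pushforward.
  + rewrite -(m_marginal mA m1_le); apply: piE.
    rewrite (_ : _ @^-1` _ = A `*` setT); first exact: regular_rectangle.
    by apply/seteqP; split=> x // [].
  + rewrite -(m_marginal mA m2_le); apply: piE.
    rewrite (_ : _ @^-1` _ = setT `*` A); first exact: regular_rectangle.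
    by apply/seteqP; split=> x // [].
- have mDelta := @closed_borel R (X1 * X2)%type Delta closedDelta.
  have := piG _ (closed_openC closedDelta).
  have -> := probability_setC pi mDelta.
  move=> h; apply/eqP; rewrite eq_le; apply/andP; split.
    exact: (probability_le1 pi mDelta).
  rewrite -sube_le0; apply: (le_trans h); rewrite lee_fin; exact: m_Delta.
- apply: layer_cake_integral_le => //; first exact: lsc_borel_measurable.
  move=> s N s0.
  apply: (le_trans (y := (\sum_(k < N) s * m [set x | k.+1%:R * s < c x])%:E));
    last by rewrite lee_fin m_layers.
  rewrite -sumEFin; apply: lee_sum => k _; rewrite EFinM lee_pmul2l//.
  exact: piG.
Qed.

End charge_of_functional.

Lemma kantorovich_coupling : exists pi : probability (borel (X1 * X2)%type) R,
  [/\ couplings mu1 mu2 pi, pi Delta = 1%E & (\int[pi]_x (c x)%:E <= D%:E)%E].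
Proof.
have [L [LD LZ Lcone]] := @cone_functional R _ cone (@dual_coneD _ _ _ _ _ _ _ _)
  (@dual_coneZ _ _ _ _ _ _ _ _) (@dual_cone_cst _ _ _ _ _ _ _ _)
  (dual_cone_ge0 c_ge0 dualD).
exact: charge_coupling LD LZ Lcone.
Qed.

End kantorovich.

(** * Lower integrals *)

Local Open Scope ereal_scope.
Import HBNNSimple.

(** Holds for arbitrary functions, the integral of a non-negative one being a supremum over the
    simple functions below it. *)
Lemma ge0_le_lower_integral d (T : measurableType d) (R : realType)
    (mu : {measure set T -> \bar R}) (f g : T -> \bar R) :
  (forall x, 0 <= f x) -> (forall x, f x <= g x) ->
  \int[mu]_x f x <= \int[mu]_x g x.
Proof.
move=> f0 fg; have g0 x : 0 <= g x by exact: le_trans (fg x).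
rewrite !ge0_integralTE//; apply: ereal_sup_le => _ [h hf <-].
exists h => // x.
exact: le_trans (hf x) (fg x).
Qed.

Section lower_integral.
Context {R : realType} {X W : normedModType R}.
Variables (pi : probability (borel X) R) (nu : probability (borel W) R).
Variables (p : X -> W) (Delta : set X).
Hypotheses (cp : continuous p) (tpi : tight pi).
Hypothesis pi_nu : forall B : set W, measurable (B : set (borel W)) ->
  pi (p @^-1` B) = nu B.
Hypotheses (cDelta : closed Delta) (piDelta : pi Delta = 1).

Let mp : measurable_fun [set: borel X] (p : borel X -> borel W).
Proof. exact: continuous_borel_measurable. Qed.

Let mDelta : measurable (Delta : set (borel X)).
Proof. exact: closed_borel. Qed.

Let piCDelta : pi (~` Delta) = 0.
Proof.
have -> := probability_setC pi mDelta.
have -> : pi (Delta : set (borel X)) = 1 by exact: piDelta.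
by rewrite subee.
Qed.

(* [f] need not be measurable. The superlevel sets of [h] are approximated from
   inside by compact sets, whose images under [p] are compact, hence Borel. *)
Lemma lower_integral_ge (f : W -> \bar R) (h : X -> R) :
  measurable_fun setT (h : borel X -> R) -> (forall x, 0 <= h x)%R ->
  (forall w, 0 <= f w) -> (forall x, Delta x -> (h x)%:E <= f (p x)) ->
  \int[pi]_x (h x)%:E <= \int[nu]_w f w.
Proof.
move=> mh h0 f0 hf.
have If0 : 0 <= \int[nu]_w f w by exact: integral_ge0.
case E : (\int[nu]_w f w) => [D| |]; [|by rewrite leey|by rewrite E in If0].
apply: layer_cake_integral_le => // s N s0; apply/lee_addgt0Pr => e e0.
pose U k : set X := [set x | (k.+1%:R * s < h x)%R] `&` Delta.
have mU0 k : measurable ([set x | (k.+1%:R * s < h x)%R] : set (borel X)).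
  rewrite (_ : [set x | _] = h @^-1` `](k.+1%:R * s)%R, +oo[%classic).
    by rewrite -[X in measurable X]setTI; exact: mh.
  by apply/seteqP; split=> x /=; rewrite in_itv/= andbT.
have mU k : measurable (U k : set (borel X)) by apply: measurableI.
(* [N] layers of weight [s], each with error [d], lose at most [e]; [N.+1] keeps the divisor
   positive when [N = 0]. *)
pose d : R := (e / (s * N.+1%:R))%R.
have d0 : (0 < d)%R by rewrite divr_gt0// mulr_gt0.
have /choice[K KU] k : exists K, [/\ compact K, K `<=` U k &
    pi [set x | (k.+1%:R * s < h x)%R] <= nu (p @` K) + d%:E].
  have [K [G [cK oG KU UG piGK]]] := borel_regular tpi (mU k) d0.
  exists K; split => //.
  have cpK : compact (p @` K).
    by apply: continuous_compact => //; exact: continuous_subspaceT.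
  have mK := compact_borel cK.
  have mGK : measurable (G `\` K : set (borel X)).
    by apply: measurableD => //; exact: open_borel.
  have -> : nu (p @` K) = pi (p @^-1` (p @` K)).
    by rewrite pi_nu//; exact: compact_borel.
  have mpK := preimage_borel cp (compact_borel cpK).
  (* A point of the layer is off [Delta], or in [K], or in the small gap between [K] and [G]. *)
  apply: (@le_trans _ _ (pi ((p @^-1` (p @` K)) `|` (G `\` K) `|` ~` Delta : set (borel X)))).
    apply: le_measure; rewrite ?inE//.
      by apply: measurableU; [exact: measurableU|exact: measurableC].
    move=> x hx; have [Dx|nDx] := pselect (Delta x); last by right.
    left; have [Kx|nKx] := pselect (K x); first by left; exists x.
    by right; split => //; exact: UG.
  apply: (le_trans (measureU2 _ _ _)).
  - exact: measurableU.
  - exact: measurableC.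
  have piD0 : pi (~` Delta : set (borel X)) <= 0.
    by rewrite le_eqVlt (introT eqP piCDelta).
  rewrite -[leRHS]adde0 leeD//; apply: (le_trans (measureU2 _ _ _)) => //.
  by rewrite leeD2l.
have cpK k : compact (p @` K k).
  have [cK _ _] := KU k.
  by apply: continuous_compact => //; exact: continuous_subspaceT.
have mpK k := compact_borel (cpK k).
have key : \sum_(k < N) s%:E * nu (p @` K k) <= D%:E.
  rewrite -E; pose g k w : \bar R := s%:E * (\1_(p @` K k) w)%:E.
  have g0 k w : 0 <= g k w by rewrite mule_ge0// lee_fin ltW.
  have mg k : measurable_fun [set: borel W] (g k).
    by apply: measurable_funeM; exact/measurable_EFinP/measurable_indic.
  have -> : \sum_(k < N) s%:E * nu (p @` K k) = \int[nu]_w \sum_(k < N) g k w.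
    rewrite ge0_integral_sum//; apply: eq_bigr => k _.
    rewrite ge0_integralZl// ?lee_fin ?(ltW s0)//.
      by rewrite integral_indic// setIT.
    exact/measurable_EFinP/measurable_indic.
  apply: ge0_le_lower_integral => w; first by apply: sume_ge0.
  (* If [w = p x] with [x] in [K M], then [(M + 1) * s < h x <= f w], while the sum of the first
     [M + 1] terms is at most [(M + 1) * s]. *)
  suff sumg M : \sum_(k < M) g k w <= f w /\ \sum_(k < M) g k w <= (M%:R * s)%:E.
    by have [] := sumg N.
  elim: M => [|M [ih1 ih2]]; first by rewrite big_ord0 mul0r.
  rewrite big_ord_recr/= -natr1 mulrDl mul1r EFinD.
  have [[x Kx pxw]|nK] := pselect ((p @` K M) w); last first.
    rewrite /g indicE memNset// mule0 adde0; split => //.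
    by rewrite (le_trans ih2)// leeDl// lee_fin ltW.
  have -> : g M w = s%:E by rewrite /g indicE mem_set ?mule1//; exists x.
  have sM : \sum_(k < M) g k w + s%:E <= (M%:R * s)%:E + s%:E by rewrite leeD2r.
  split => //; apply: (le_trans sM).
  have [_ KUM _] := KU M; have [hx Dx] := KUM _ Kx.
  rewrite -EFinD -[X in (_ + X)%R]mul1r -mulrDl natr1 -pxw.
  by rewrite (le_trans _ (hf _ Dx))// lee_fin ltW.
apply: (@le_trans _ _ (\sum_(k < N) (s%:E * nu (p @` K k) + (s * d)%:E))).
  apply: lee_sum => k _; have [_ _ piU] := KU k.
  rewrite EFinM -muleDr//; last by rewrite fin_num_adde_defl.
  by rewrite lee_pmul2l.
rewrite big_split/= leeD// sumEFin lee_fin sumr_const card_ord -mulr_natl.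
rewrite /d !mulrA ler_pdivrMr ?mulr_gt0// [leLHS](_ : _ = e * (s * N%:R))%R; last by ring.
by rewrite ler_pM2l// ler_pM2l// ler_nat.
Qed.

(** A simple function below [f], composed with [p], is at most [h] on [Delta], hence [pi]-almost
    everywhere; being measurable, its integral is transported by [p]. *)
Lemma lower_integral_le (f : W -> \bar R) (h : X -> R) :
  measurable_fun setT (h : borel X -> R) -> (forall x, 0 <= h x)%R ->
  (forall w, 0 <= f w) -> (forall x, Delta x -> f (p x) <= (h x)%:E) ->
  \int[nu]_w f w <= \int[pi]_x (h x)%:E.
Proof.
move=> mh h0 f0 fh; rewrite ge0_integralTE//.
apply: ge_ereal_sup => _ [g gf <-].
have -> : sintegral nu g = \int[nu]_w (g w)%:E.
  by rewrite integral_nnsfun// patch_setT.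
have -> : \int[nu]_w (g w)%:E = \int[pushforward pi (p : borel X -> borel W)]_w (g w)%:E.
  by apply: eq_measure_integral => B mB _; exact/esym/pi_nu.
have mg : measurable_fun [set: borel W] (EFin \o g) by exact/measurable_EFinP.
rewrite ge0_integral_pushforward//; last by move=> w _; rewrite lee_fin.
rewrite preimage_setT; apply: ae_ge0_le_integral => //.
- by move=> x _; rewrite lee_fin.
- exact: measurableT_comp.
- by move=> x _; rewrite lee_fin.
- exact/measurable_EFinP.
- exists (~` Delta); split => //; first exact: measurableC.
  move=> x nle Dx; apply: nle => _ /=.
  exact: le_trans (gf _) (fh _ Dx).
Qed.

Let integrable_parts (h : X -> R) : L1 pi h ->
  [/\ measurable_fun setT (h^\+%R : borel X -> R),
      measurable_fun setT (h^\-%R : borel X -> R),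
      \int[pi]_x (h^\+%R x)%:E \is a fin_num,
      \int[pi]_x (h^\-%R x)%:E \is a fin_num &
      \int[pi]_x (h x)%:E = \int[pi]_x (h^\+%R x)%:E - \int[pi]_x (h^\-%R x)%:E].
Proof.
move=> ih; have mh : measurable_fun setT (h : borel X -> R).
  by apply/measurable_EFinP; exact: measurable_int ih.
split.
- exact: measurable_funrpos.
- exact: measurable_funrneg.
- have := @integrable_pos_fin_num _ _ _ _ setT measurableT _ ih.
  by rewrite funerpos.
- have := @integrable_neg_fin_num _ _ _ _ setT measurableT _ ih.
  by rewrite funerneg.
- have := integralE pi setT (EFin \o h : borel X -> \bar R).
  by rewrite funerpos funerneg.
Qed.

Let le_maxe0 (a b : \bar R) : a <= b -> maxe a 0 <= maxe b 0.
Proof. by move=> ab; rewrite ge_max !le_max ab lexx orbT. Qed.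

(** The positive parts are compared by [lower_integral_le], the negative ones, where the inequality
    is reversed, by [lower_integral_ge]. *)
Lemma lower_integral_le_integrable (f : W -> \bar R) (h : X -> R) : L1 pi h ->
  (forall x, Delta x -> f (p x) <= (h x)%:E) ->
  \int[nu]_w f w <= \int[pi]_x (h x)%:E.
Proof.
move=> /integrable_parts[mhp mhn fp fn ->] fh; rewrite integralE leeB//.
- apply: lower_integral_le => // x /fh fhx.
  by rewrite funeposE /funrpos EFin_max le_maxe0.
- apply: lower_integral_ge => // x /fh fhx.
  by rewrite funenegE /funrneg EFin_max EFinN le_maxe0// leeN2.
Qed.

Lemma lower_integral_ge_integrable (f : W -> \bar R) (h : X -> R) : L1 pi h ->
  (forall x, Delta x -> (h x)%:E <= f (p x)) ->
  \int[pi]_x (h x)%:E <= \int[nu]_w f w.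
Proof.
move=> /integrable_parts[mhp mhn fp fn ->] fh; rewrite [leRHS]integralE leeB//.
- apply: lower_integral_ge => // x /fh fhx.
  by rewrite funeposE /funrpos EFin_max le_maxe0.
- apply: lower_integral_le => // x /fh fhx.
  by rewrite funenegE /funrneg EFin_max EFinN le_maxe0// leeN2.
Qed.

End lower_integral.

(** * Duality *)

Lemma continuous_fst {T1 T2 : topologicalType} : continuous (@fst T1 T2).
Proof. by move=> x; exact: cvg_fst. Qed.

Lemma continuous_snd {T1 T2 : topologicalType} : continuous (@snd T1 T2).
Proof. by move=> x; exact: cvg_snd. Qed.

Lemma tight_marginals {R : realType} {X1 X2 : normedModType R}
    (pi : probability (borel (X1 * X2)%type) R)
    (m1 : set X1 -> \bar R) (m2 : set X2 -> \bar R) :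
  (forall A : set X1, measurable (A : set (borel X1)) -> pi (fst @^-1` A) = m1 A) ->
  (forall A : set X2, measurable (A : set (borel X2)) -> pi (snd @^-1` A) = m2 A) ->
  tight m1 -> tight m2 -> tight pi.
Proof.
move=> pi1 pi2 t1 t2.
(* [tight_prod] asks for monotonicity and subadditivity on all sets, hence the outer measure. *)
pose m : set (X1 * X2) -> \bar R := mu_ext pi.
have mE (A : set (X1 * X2)) : measurable (A : set (borel (X1 * X2)%type)) -> m A = pi A.
  exact: measurable_mu_extE.
have tm : tight m.
  apply: (tight_prod _ _ _ _ t1 t2).
  - by move=> A B AB; exact: (@le_mu_ext _ _ R pi A B).
  - by move=> A B; exact: (outer_measureU2 (mu_ext pi) A B).
  - move=> K cK; have mK := measurableC (compact_borel cK).
    rewrite mE; last exact: (preimage_borel continuous_fst).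
    by rewrite le_eqVlt pi1 ?eqxx.
  - move=> K cK; have mK := measurableC (compact_borel cK).
    rewrite mE; last exact: (preimage_borel continuous_snd).
    by rewrite le_eqVlt pi2 ?eqxx.
move=> e e0; have [K cK mKe] := tm e e0; exists K => //.
by rewrite -mE//; apply: measurableC; exact: compact_borel.
Qed.

Lemma pushforward_probability {R : realType} {X W : normedModType R}
    (pi : probability (borel X) R) (p : X -> W) : continuous p ->
  exists nu : probability (borel W) R,
    forall B : set W, measurable (B : set (borel W)) -> pi (p @^-1` B) = nu B.
Proof.
move=> cp.
have mp := continuous_borel_measurable cp.
pose nu_of : {measure set (borel W) -> \bar R} :=
  pushforward pi (p : borel X -> borel W).
pose nu0 := nu_of mp.
have nuT : nu0 setT = 1.
  by have := probability_setT pi; rewrite /nu0/= /pushforward preimage_setT.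
pose nu : probability (borel W) R := HB.pack (nu0 : set _ -> \bar R)
  (Measure.class nu0) (Measure_isProbability.Build _ _ _ nu0 nuT).
by exists nu.
Qed.

Lemma ulam_prod {R : realType} {X1 X2 : completeNormedModType R}
    (mu : probability (borel (X1 * X2)%type) R) :
  separable X1 -> separable X2 -> tight mu.
Proof.
move=> s1 s2.
have [mu1 mu1E] := pushforward_probability mu (@continuous_fst X1 X2).
have [mu2 mu2E] := pushforward_probability mu (@continuous_snd X1 X2).
exact: tight_marginals mu1E mu2E (ulam mu1 s1) (ulam mu2 s2).
Qed.

Section change_of_variables.
Context {R : realType} {X W : normedModType R}.
Variables (pi : probability (borel X) R) (nu : probability (borel W) R).
Variables (p : X -> W).
Hypotheses (cp : continuous p) (tpi : tight pi).
Hypothesis pi_nu : forall B : set W, measurable (B : set (borel W)) ->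
  pi (p @^-1` B) = nu B.

Let piT : pi setT = 1. Proof. exact: probability_setT. Qed.

(** Both inequalities are the lower-integral comparisons with [Delta] the whole space and
    [h = f \o p]. *)
Lemma L1_comp (f : W -> R) : L1 nu f -> L1 pi (f \o p) /\
  \int[pi]_x (f (p x))%:E = \int[nu]_w (f w)%:E.
Proof.
move=> fnu; have mf : measurable_fun [set: borel W] (f : borel W -> R).
  by apply/measurable_EFinP; exact: measurable_int fnu.
have mfp : measurable_fun [set: borel X] (f \o p : borel X -> R).
  exact: (measurableT_comp mf (continuous_borel_measurable cp)).
have fpi : L1 pi (f \o p).
  apply/integrableP; split; first exact/measurable_EFinP.
  have /integrableP[_] := fnu; apply: le_lt_trans.
  apply: (lower_integral_ge cp tpi pi_nu closedT piT (h := fun x => `|f (p x)|%R)) => //.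
  exact: (measurableT_comp (@normr_measurable R setT) mfp).
split => //; apply/eqP; rewrite eq_le; apply/andP; split.
  exact: (lower_integral_ge_integrable cp tpi pi_nu closedT piT (h := f \o p)).
exact: (lower_integral_le_integrable cp tpi pi_nu closedT piT (h := f \o p)).
Qed.

End change_of_variables.

Lemma le_lower_integral {R : realType} {X : normedModType R}
    (mu : probability (borel X) R) (f : X -> R) (g : X -> \bar R) :
  tight mu -> L1 mu f -> (forall x, (f x)%:E <= g x) ->
  \int[mu]_x (f x)%:E <= \int[mu]_x g x.
Proof.
move=> tmu Lf fg.
have cid : continuous (@id X) by move=> x; exact: cvg_id.
have muT : mu setT = 1 by exact: probability_setT.
exact: (lower_integral_ge_integrable cid tmu (fun _ _ => erefl) closedT muT Lf
  (fun x _ => fg x)).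
Qed.

Lemma ge_lower_integral {R : realType} {X : normedModType R}
    (mu : probability (borel X) R) (f : X -> R) (g : X -> \bar R) :
  tight mu -> L1 mu f -> (forall x, g x <= (f x)%:E) ->
  \int[mu]_x g x <= \int[mu]_x (f x)%:E.
Proof.
move=> tmu Lf fg.
have cid : continuous (@id X) by move=> x; exact: cvg_id.
have muT : mu setT = 1 by exact: probability_setT.
exact: (lower_integral_le_integrable cid tmu (fun _ _ => erefl) closedT muT Lf
  (fun x _ => fg x)).
Qed.

Lemma L1_Rintegral {R : realType} {X : normedModType R}
    (mu : probability (borel X) R) (f : X -> R) : L1 mu f ->
  \int[mu]_x (f x)%:E = (\int[mu]_x f x)%R%:E.
Proof. by move=> Lf; rewrite /Rintegral fineK//; exact: integrable_fin_num. Qed.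

Section partial_transport.
Context {R : realType} {Y U V : completeNormedModType R}.
Hypotheses (sepY : separable Y) (sepU : separable U) (sepV : separable V).
Variables (eta : probability (borel (Y * V)%type) R)
  (nu : probability (borel (Y * U)%type) R).
Variable c : (Y * V) * (Y * U) -> R.
Hypotheses (c_lsc : forall r, open [set x | (r < c x)%R])
  (c_ge0 : forall x, (0 <= c x)%R).

Definition diagonalY := [set x : (Y * V) * (Y * U) | x.1.1 = x.2.1].

Lemma closed_diagonalY : closed diagonalY.
Proof.
have cf : continuous (fun x : (Y * V) * (Y * U) => x.1.1 - x.2.1)%R.
  move=> x; apply: cvgB.
    by apply: continuous_comp; exact: continuous_fst.
  apply: continuous_comp; first exact: continuous_snd.
  exact: continuous_fst.
rewrite (_ : diagonalY = (fun x : (Y * V) * (Y * U) => x.1.1 - x.2.1)%R @^-1` [set 0%R]).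
  move/continuous_closedP : cf; apply; apply: compact_closed_normed.
  exact: compact_set1.
apply/seteqP; split=> x /=; first by move=> ->; rewrite subrr.
by move/eqP; rewrite subr_eq0 => /eqP.
Qed.

(** * Weak duality *)

Section weak_duality.
Variable pi : probability (borel ((Y * V) * (Y * U))%type) R.
Hypothesis pi_coupling : couplingsY eta nu pi.

Let pi1 (A : set (Y * V)) : measurable (A : set (borel (Y * V)%type)) ->
  pi (fst @^-1` A) = eta A.
Proof. exact: pi_coupling.1.1. Qed.

Let pi2 (A : set (Y * U)) : measurable (A : set (borel (Y * U)%type)) ->
  pi (snd @^-1` A) = nu A.
Proof. exact: pi_coupling.1.2. Qed.

Let tpi : tight pi.
Proof. exact: tight_marginals pi1 pi2 (ulam_prod eta sepY sepV) (ulam_prod nu sepY sepU). Qed.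

Let L1c : transport_cost c pi < +oo -> L1 pi c.
Proof.
move=> Kfin; apply/integrableP; split.
  by apply/measurable_EFinP; exact: lsc_borel_measurable.
by under eq_integral do rewrite gee0_abs ?lee_fin//.
Qed.

(** On the diagonal the transform is at most [psi + c], whose integral under [pi] bounds its lower
    integral. An infinite cost is trivial, and a finite one makes [c] integrable. *)
Lemma dual_v_le psi : L1 eta psi -> dual_v c eta nu psi <= transport_cost c pi.
Proof.
move=> Lpsi; have [Kfin|] := ltP (transport_cost c pi) +oo; last first.
  by rewrite leye_eq => /eqP ->; rewrite leey.
have Lc := L1c Kfin.
have [Lpsi1 E1] := L1_comp (@continuous_fst _ _) tpi pi1 Lpsi.
have [Lh _] := L1D Lpsi1 Lc.
rewrite /dual_v -E1 leeBlDr; last exact: integrable_fin_num.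
rewrite addeC /transport_cost -integralD_EFin//.
apply: (lower_integral_le_integrable (@continuous_snd _ _) tpi pi2 closed_diagonalY _ Lh).
  exact: pi_coupling.2.
move=> [[y v] [y' u]]; rewrite /diagonalY/= => ->.
by apply: ereal_inf_lbound; exists v.
Qed.

Lemma dual_u_le phi : L1 nu phi -> dual_u c eta nu phi <= transport_cost c pi.
Proof.
move=> Lphi; have [Kfin|] := ltP (transport_cost c pi) +oo; last first.
  by rewrite leye_eq => /eqP ->; rewrite leey.
have Lc := L1c Kfin.
have [Lphi2 E2] := L1_comp (@continuous_snd _ _) tpi pi2 Lphi.
have [LNc EN] := L1Z (-1) Lc.
have [Lh Eh] := L1D Lphi2 LNc.
have := lower_integral_ge_integrable (@continuous_fst _ _) tpi pi1 closed_diagonalY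
  pi_coupling.2 (f := ctransform_u c phi) Lh.
rewrite (L1_Rintegral Lh) Eh EN mulN1r => le_u.
rewrite /dual_u -E2 (L1_Rintegral Lphi2) /transport_cost (L1_Rintegral Lc).
have {}le_u : (\int[pi]_x (phi \o snd) x - \int[pi]_x c x)%R%:E <=
    \int[eta]_q ctransform_u c phi q.
  apply: le_u => -[[y v] [y' u]]; rewrite /diagonalY/= => ->.
  by apply: ereal_sup_ubound; exists u => //; rewrite mulN1r.
(* The bound [le_u] excludes [-oo]; at [+oo] the dual value is [-oo]. *)
move: le_u; case: (\int[eta]_q _) => [r| |] //=; last by rewrite leNye.
by rewrite -EFinB !lee_fin !lerBlDr [(r + _)%R]addrC.
Qed.

End weak_duality.

(** The null pair shows [0 <= Q]; an infinite [Q] is trivial, and a real one is the bound [D] for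
    which [kantorovich_coupling] gives a coupling. Leaving [Q] free lets both dual suprema take its
    place. *)
Lemma strong_duality (Q : \bar R) :
  (forall psi phi, L1 eta psi -> L1 nu phi ->
    (forall x, diagonalY x -> phi x.2 - psi x.1 <= c x)%R ->
    \int[nu]_p (phi p)%:E - \int[eta]_q (psi q)%:E <= Q) ->
  ereal_inf [set transport_cost c pi | pi in couplingsY eta nu] <= Q.
Proof.
move=> dualQ.
have [L0eta E0eta] := L1cst eta 0; have [L0nu E0nu] := L1cst nu 0.
have Q0 : 0 <= Q.
  have := dualQ _ _ L0eta L0nu.
  rewrite (L1_Rintegral L0eta) (L1_Rintegral L0nu) E0eta E0nu subee//.
  by apply=> x _; rewrite subr0.
case: Q Q0 dualQ => [D| |]//= _ dualD; last by rewrite leey.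
have dD : dual_bound eta nu diagonalY c D.
  move=> psi phi Lpsi Lphi feas; rewrite -lee_fin.
  have := dualD _ _ Lpsi Lphi feas.
  by rewrite (L1_Rintegral Lpsi) (L1_Rintegral Lphi) -EFinB.
have [pi [cpi piD cost]] := kantorovich_coupling (separable_prod sepY sepV)
  (separable_prod sepY sepU) (ulam_prod eta sepY sepV) (ulam_prod nu sepY sepU)
  closed_diagonalY c_lsc c_ge0 dD.
by apply: le_trans cost; apply: ereal_inf_lbound; exists pi.
Qed.

Lemma dual_v_ge psi phi : L1 eta psi -> L1 nu phi ->
  (forall x, diagonalY x -> phi x.2 - psi x.1 <= c x)%R ->
  \int[nu]_p (phi p)%:E - \int[eta]_q (psi q)%:E <= dual_v c eta nu psi.
Proof.
move=> Lpsi Lphi feas; rewrite /dual_v leeD2r//.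
apply: le_lower_integral => //; first exact: ulam_prod.
move=> [y u]; apply: le_ereal_inf_tmp => _ [v _ <-]; rewrite lee_fin.
by have := feas ((y, v), (y, u)) erefl => /=; lra.
Qed.

Lemma dual_u_ge psi phi : L1 eta psi -> L1 nu phi ->
  (forall x, diagonalY x -> phi x.2 - psi x.1 <= c x)%R ->
  \int[nu]_p (phi p)%:E - \int[eta]_q (psi q)%:E <= dual_u c eta nu phi.
Proof.
move=> Lpsi Lphi feas; rewrite /dual_u leeB//.
apply: ge_lower_integral => //; first exact: ulam_prod.
move=> [y v]; apply: ge_ereal_sup => _ [u _ <-]; rewrite lee_fin.
by have := feas ((y, v), (y, u)) erefl => /=; lra.
Qed.

End partial_transport.

Theorem theorem1p6 (R : realType) (Y U V : completeNormedModType R)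
  (hilbertY : hilbert Y) (hilbertU : hilbert U) (hilbertV : hilbert V)
  (sepY : separable Y) (sepU : separable U) (sepV : separable V)
  (nu : probability (borel (Y * U)%type) R)
  (etaV : probability (borel V) R)
  (eta : probability (borel (Y * V)%type) R)
  (eta_prod : is_product eta (marginal1 nu) etaV)
  (c : (Y * V) * (Y * U) -> R)
  (c_lsc : lower_semicontinuous (EFin \o c))
  (c_ge0 : forall x, (0 <= c x)%R) :
  ereal_inf [set transport_cost c pi | pi in couplingsY eta nu]
    = ereal_sup [set dual_v c eta nu psi | psi in L1 eta]
  /\
  ereal_sup [set dual_v c eta nu psi | psi in L1 eta]
    = ereal_sup [set dual_u c eta nu phi | phi in L1 nu].
Proof.
have c_open r : open [set x | (r < c x)%R].
  by move/lower_semicontinuousP : c_lsc => /(_ r).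
(* Common to both dual problems: [d] satisfies weak duality and one of its values dominates each
   admissible pair. *)
have infE (I : Type) (A : set I) (d : I -> \bar R) :
    (forall i pi, A i -> couplingsY eta nu pi -> d i <= transport_cost c pi) ->
    (forall psi phi, L1 eta psi -> L1 nu phi ->
      (forall x, diagonalY x -> phi x.2 - psi x.1 <= c x)%R ->
      exists2 i, A i & \int[nu]_p (phi p)%:E - \int[eta]_q (psi q)%:E <= d i) ->
    ereal_inf [set transport_cost c pi | pi in couplingsY eta nu] =
    ereal_sup [set d i | i in A].
  move=> weak feas; apply/eqP; rewrite eq_le; apply/andP; split; last first.
    apply: ge_ereal_sup => _ [i Ai <-]; apply: le_ereal_inf_tmp => _ [pi cpi <-].
    exact: weak.
  apply: strong_duality => // psi phi Lpsi Lphi f.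
  have [i Ai /le_trans] := feas _ _ Lpsi Lphi f; apply.
  by apply: ereal_sup_ubound; exists i.
have v : ereal_inf [set transport_cost c pi | pi in couplingsY eta nu] =
    ereal_sup [set dual_v c eta nu psi | psi in L1 eta].
  apply: infE => [psi pi Lpsi cpi|psi phi Lpsi Lphi f]; first exact: dual_v_le.
  by exists psi => //; exact: dual_v_ge.
have u : ereal_inf [set transport_cost c pi | pi in couplingsY eta nu] =
    ereal_sup [set dual_u c eta nu phi | phi in L1 nu].
  apply: infE => [phi pi Lphi cpi|psi phi Lpsi Lphi f]; first exact: dual_u_le.
  by exists phi => //; exact: dual_u_ge.
by split; rewrite -v.
Qed.
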